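(* Let $\{G_n\}_{n\in\mathbb{N}}$ be any family of compact connected Hausdorff topological groups such that each $G_n$ has weight at most $2^{\aleph_0}$. Then there exists a type-absolutely connected group $G$, equipped with some first-order structure expanding the group structure, such that for a monster model $G^*$ of $G$ the group $\prod_{n\in\mathbb{N}}G_n/\bigoplus_{n\in\mathbb{N}}G_n$ is a homomorphic image of ${G^*}^{00}_{\emptyset}/{G^*}^{\infty}_{\emptyset}$. If infinitely many of the $G_n$ are non-abelian, then ${G^*}^{00}_{\emptyset}/{G^*}^{\infty}_{\emptyset}$ is also non-abelian.
   Context: The weight of a topological space is the minimal cardinality of a base of its topology. A monster model (sufficiently saturated extension) $G^*$ of a group $(G,\cdot,\dots)$ with first-order structure is a $\kappa$-saturated and $\kappa$-strongly homogeneous elementary extension, for a sufficiently big cardinal $\kappa$; ''small'' means of cardinality $<\kappa$, and an $A$-invariant subgroup (invariant under automorphisms of $G^*$ fixing the small set $A$ pointwise) has bounded index if its index in $G^*$ is $<\kappa$. ${G^*}^{00}_{A}$ is the intersection of all subgroups of $G^*$ of bounded index that are type-definable over $A$; ${G^*}^{\infty}_{A}$ is the intersection of all $A$-invariant subgroups of $G^*$ of bounded index. Both are normal subgroups of bounded index and ${G^*}^{\infty}_A\subseteq {G^*}^{00}_A$. A subset $P$ of a group $G$ is $n$-thick if $P=P^{-1}$ and for every sequence $g_1,\dots,g_n$ in $G$ (not necessarily distinct) there are $1\le i<j\le n$ with $g_i^{-1}g_j\in P$; thick means $n$-thick for some $n\in\mathbb{N}$. A group $G$ is type-absolutely connected if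 for any sufficiently saturated extension $G^*$ of any first-order expansion of $G$ one has $G^*={G^*}^{00}_G$; equivalently, for every family $\{P_n:n\in\mathbb{N}\}$ of thick subsets of $G$ with $P_{n+1}P_{n+1}\subseteq P_n$ for all $n$, one has $P_n=G$ for all $n$. *)

(* Defs.v *)
From HB Require Import structures.
From mathcomp Require Import all_boot all_classical topology.

Set Implicit Arguments.
Unset Strict Implicit.
Unset Printing Implicit Defensive.

Local Open Scope classical_set_scope.
Local Open Scope card_scope.
Local Open Scope group_scope.

HB.mixin Record isTopologicalGroup T of Topological T & Group T := {
  mulg_continuous : continuous (fun xy : T * T => xy.1 * xy.2);
  invg_continuous : continuous (fun x : T => x^-1)
}.

#[short(type="topologicalGroupType")]
HB.structure Definition TopologicalGroup :=
  {T of Topological T & Group T & isTopologicalGroup T}.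

Definition weight_le (T : topologicalType) (U : Type) (C : set U) :=
  exists2 B : set (set T), B #<= C & basis B.

Definition abelian_group (G : groupType) := forall x y : G, commute x y.

Definition is_subgroup (G : groupType) (H : set G) :=
  [/\ H 1, forall x y, H x -> H y -> H (x * y) & forall x, H x -> H x^-1].

Definition left_coset (G : groupType) (H : set G) (x : G) : set G :=
  [set x * h | h in H].

Definition is_normal_in (G : groupType) (N H : set G) :=
  [/\ is_subgroup H, is_subgroup N, N `<=` H &
      forall h n, H h -> N n -> N (n ^ h)].

(* The group H / N, as the set of the cosets x N with x in H, under the *)
(* product of subsets. *)
Definition quotient_group (G : groupType) (N H : set G)
    (nNH : is_normal_in N H) : Type :=
  {C : set G | exists2 x, H x & C = left_coset N x}.

Section QuotientGroup.
Variables (G : groupType) (N H : set G) (nNH : is_normal_in N H).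

Let T := quotient_group nNH.

HB.instance Definition _ := gen_eqMixin (quotient_group nNH).
HB.instance Definition _ := gen_choiceMixin (quotient_group nNH).

Let mul_set (C D : set G) : set G := [set x * y | x in C & y in D].
Let inv_set (C : set G) : set G := [set x^-1 | x in C].

Lemma mul_left_coset x y : H x -> H y ->
  mul_set (left_coset N x) (left_coset N y) = left_coset N (x * y).
Proof.
case: nNH => -[H1 HM HV] [N1 NM NV] sNH NJ Hx Hy; apply/seteqP; split.
  move=> _ [_ [n Nn <-]] [_ [m Nm <-]] <-; exists (n ^ y * m).
    by apply: NM => //; exact: NJ.
  by rewrite conjgE !mulgA mulgK.
move=> _ [n Nn <-]; exists x; first by exists 1; rewrite ?mulg1.
by exists (y * n); rewrite ?mulgA //; exists n.
Qed.

Lemma inv_left_coset x : H x ->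
  inv_set (left_coset N x) = left_coset N x^-1.
Proof.
case: nNH => -[H1 HM HV] [N1 NM NV] sNH NJ Hx; apply/seteqP; split.
  move=> _ [_ [n Nn <-]] <-; exists (n^-1 ^ x^-1).
    by apply: NJ; [exact: HV|exact: NV].
  by rewrite conjgE invgK invgM !mulgA mulVg mul1g.
move=> _ [n Nn <-]; exists (x * (n^-1 ^ x)).
  by exists (n^-1 ^ x) => //; apply: NJ => //; exact: NV.
by rewrite conjgE !mulgA mulgV mul1g invgM invgK.
Qed.

Let quotient_repr (C : T) : exists2 x, H x & sval C = left_coset N x.
Proof. exact: (proj2_sig C). Qed.

Let mulT_subproof (C D : T) :
  exists2 x, H x & mul_set (sval C) (sval D) = left_coset N x.
Proof.
have [x Hx ->] := quotient_repr C; have [y Hy ->] := quotient_repr D.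
exists (x * y); last exact: mul_left_coset.
by case: nNH => -[_ HM _] _ _ _; exact: HM.
Qed.

Let invT_subproof (C : T) :
  exists2 x, H x & inv_set (sval C) = left_coset N x.
Proof.
have [x Hx ->] := quotient_repr C.
exists x^-1; last exact: inv_left_coset.
by case: nNH => -[_ _ HV] _ _ _; exact: HV.
Qed.

Let oneT_subproof : exists2 x, H x & N = left_coset N x.
Proof.
exists 1; first by case: nNH => -[].
by rewrite /left_coset (_ : *%g 1 = id) ?image_id//; apply/funext => x; rewrite mul1g.
Qed.

Definition quotient_mul (C D : T) : T :=
  exist _ (mul_set (sval C) (sval D)) (mulT_subproof C D).
Definition quotient_inv (C : T) : T :=
  exist _ (inv_set (sval C)) (invT_subproof C).
Definition quotient_one : T := exist _ N oneT_subproof.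

Let val_one : sval quotient_one = left_coset N 1.
Proof.
by rewrite /= /left_coset (_ : *%g 1 = id) ?image_id//; apply/funext => x; rewrite mul1g.
Qed.

Let subH1 : H 1. Proof. by case: nNH => -[]. Qed.
Let subHM x y : H x -> H y -> H (x * y).
Proof. by case: nNH => -[_ HM _] _ _ _; exact: HM. Qed.
Let subHV x : H x -> H x^-1.
Proof. by case: nNH => -[_ _ HV] _ _ _; exact: HV. Qed.

Let sval_inj (C D : T) : sval C = sval D -> C = D.
Proof. by case: C D => [C pC] [D pD] /= CD; exact: eq_exist. Qed.

Let quotient_mulA : associative quotient_mul.
Proof.
move=> C D E; apply: sval_inj => /=.
have [x Hx ->] := quotient_repr C; have [y Hy ->] := quotient_repr D.
have [z Hz ->] := quotient_repr E.
by rewrite !mul_left_coset ?mulgA//; exact: subHM.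
Qed.

Let quotient_mul1 : left_id quotient_one quotient_mul.
Proof.
move=> C; apply: sval_inj.
rewrite -[RHS]/(sval C) -[LHS]/(mul_set (sval quotient_one) (sval C)) val_one.
by have [x Hx ->] := quotient_repr C; rewrite mul_left_coset ?mul1g.
Qed.

Let quotient_mulr1 : right_id quotient_one quotient_mul.
Proof.
move=> C; apply: sval_inj.
rewrite -[RHS]/(sval C) -[LHS]/(mul_set (sval C) (sval quotient_one)) val_one.
by have [x Hx ->] := quotient_repr C; rewrite mul_left_coset ?mulg1.
Qed.

Let quotient_mulV : left_inverse quotient_one quotient_inv quotient_mul.
Proof.
move=> C; apply: sval_inj.
rewrite -[RHS]/(sval quotient_one) val_one /=.
have [x Hx ->] := quotient_repr C.
by rewrite inv_left_coset// mul_left_coset ?mulVg//; exact: subHV.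
Qed.

Let quotient_mulrV : right_inverse quotient_one quotient_inv quotient_mul.
Proof.
move=> C; apply: sval_inj.
rewrite -[RHS]/(sval quotient_one) val_one /=.
have [x Hx ->] := quotient_repr C.
by rewrite inv_left_coset// mul_left_coset ?mulgV//; exact: subHV.
Qed.

HB.instance Definition _ := isGroup.Build (quotient_group nNH)
  quotient_mulA quotient_mul1 quotient_mulr1 quotient_mulV quotient_mulrV.

End QuotientGroup.

Definition product_group (I : Type) (G : I -> groupType) : Type :=
  forall i, G i.

Section ProductGroup.
Variables (I : Type) (G : I -> groupType).

Let T := product_group G.

HB.instance Definition _ := gen_eqMixin (product_group G).
HB.instance Definition _ := gen_choiceMixin (product_group G).

Let mulT (f g : T) : T := fun i => f i * g i.
Let invT (f : T) : T := fun i => (f i)^-1.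
Let oneT : T := fun=> 1.

Let mulTA : associative mulT.
Proof. by move=> f g h; apply: functional_extensionality_dep => i; exact: mulgA. Qed.
Let mul1T : left_id oneT mulT.
Proof. by move=> f; apply: functional_extensionality_dep => i; exact: mul1g. Qed.
Let mulT1 : right_id oneT mulT.
Proof. by move=> f; apply: functional_extensionality_dep => i; exact: mulg1. Qed.
Let mulVT : left_inverse oneT invT mulT.
Proof. by move=> f; apply: functional_extensionality_dep => i; exact: mulVg. Qed.
Let mulTV : right_inverse oneT invT mulT.
Proof. by move=> f; apply: functional_extensionality_dep => i; exact: mulgV. Qed.

HB.instance Definition _ := isGroup.Build (product_group G)
  mulTA mul1T mulT1 mulVT mulTV.

Definition direct_sum : set (product_group G) :=
  [set f | finite_set [set i | f i <> 1]].

Lemma direct_sum_normal : is_normal_in direct_sum [set: product_group G].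
Proof.
split=> //; last first.
  move=> h f _; apply: sub_finite_set => i /=; apply: contra_not => fi1.
  by rewrite -[LHS]/((h i)^-1 * (f i * h i)) fi1 mul1g mulVg.
split=> /=.
- by apply: (@sub_finite_set _ _ set0) => // i /=; apply.
- move=> f g fd gd; apply: (@sub_finite_set _ _
    ([set i | f i <> 1] `|` [set i | g i <> 1])); last by rewrite finite_setU.
  move=> i /= fgi; apply: contrapT => /not_orP[/contrapT fi1 /contrapT gi1].
  by apply: fgi; rewrite -[LHS]/(f i * g i) fi1 gi1 mul1g.
- move=> f; apply: sub_finite_set => i /=; apply: contra_not => fi1.
  by rewrite -[LHS]/((f i)^-1) fi1 invg1.
Qed.

End ProductGroup.

(* Cardinals are represented by types. The universe is the one of the carriers *)
(* of groups: in a larger one, a "sufficiently big" cardinal could exceed the *)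
(* cardinality of every group, and there would be no saturated model. *)
Definition cardinal := Type@{Group.axioms_.u0}.

Definition small (K : cardinal) (T : Type) (A : set T) :=
  ~ ([set: K] #<= A).

Definition for_sufficiently_big (P : cardinal -> Prop) :=
  exists K0 : cardinal, forall K : cardinal, [set: K0] #<= [set: K] -> P K.

(* The symbols of a first-order language besides those of the group language, *)
(* which are built into the terms below. *)
Record language := Language {
  fun_symbol : Type@{Group.axioms_.u0};
  fun_arity : fun_symbol -> nat;
  rel_symbol : Type@{Group.axioms_.u0};
  rel_arity : rel_symbol -> nat
}.

Record expansion (L : language) (G : groupType) := Expansion {
  fun_interp : forall f : fun_symbol L, ('I_(fun_arity f) -> G) -> G;
  rel_interp : forall r : rel_symbol L, ('I_(rel_arity r) -> G) -> Prop
}.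

Inductive term (L : language) (V : Type) :=
| TVar of V
| TOne
| TInv of term L V
| TMul of term L V & term L V
| TFun (f : fun_symbol L) of ('I_(fun_arity f) -> term L V).

(* First-order formulas with free variables in V; in FAll the new variable is *)
(* None. With V := A or V := option A, where A is a subset of a structure, *)
(* these are the sentences, resp. the formulas in one variable, with *)
(* parameters in A. *)
Inductive formula (L : language) (V : Type) :=
| FFalse
| FEq of term L V & term L V
| FRel (r : rel_symbol L) of ('I_(rel_arity r) -> term L V)
| FImp of formula L V & formula L V
| FAll of formula L (option V).

Section Semantics.
Variables (L : language) (G : groupType) (S : expansion L G).

Fixpoint eval V (v : V -> G) (t : term L V) : G :=
  match t with
  | TVar x => v x
  | TOne => 1
  | TInv t => (eval v t)^-1
  | TMul t u => eval v t * eval v u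
  | TFun f ts => fun_interp S (fun i => eval v (ts i))
  end.

Fixpoint sat V (v : V -> G) (phi : formula L V) : Prop :=
  match phi with
  | FFalse => False
  | FEq t u => eval v t = eval v u
  | FRel r ts => rel_interp S (fun i => eval v (ts i))
  | FImp phi psi => sat v phi -> sat v psi
  | FAll phi => forall x : G, sat (oapp v x) phi
  end.

Definition realizes (A : set G) (p : set (formula L (option A))) (x : G) :=
  forall phi, p phi -> sat (oapp val x) phi.

Definition saturated (K : cardinal) :=
  forall A : set G, small K A -> forall p : set (formula L (option A)),
    (forall q, finite_set q -> q `<=` p -> exists x, realizes q x) ->
    exists x, realizes p x.

Definition automorphism (s : G -> G) :=
  [/\ bijective s,
      {morph s : x y / x * y},
      forall f (xs : 'I_(fun_arity f) -> G),
        s (fun_interp S xs) = fun_interp S (s \o xs) &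
      forall r (xs : 'I_(rel_arity r) -> G),
        rel_interp S (s \o xs) <-> rel_interp S xs].

Definition elementary_map (A : set G) (f : A -> G) :=
  forall phi : formula L A, sat val phi <-> sat f phi.

Definition strongly_homogeneous (K : cardinal) :=
  forall A : set G, small K A -> forall f : A -> G, elementary_map f ->
    exists2 s, automorphism s & forall a : A, s (val a) = f a.

Definition bounded_index (K : cardinal) (H : set G) :=
  small K (range (left_coset H)).

Definition invariant (A H : set G) :=
  forall s, automorphism s -> (forall a, A a -> s a = a) -> s @` H = H.

Definition type_definable (A H : set G) :=
  exists p : set (formula L (option A)), H = [set x | realizes p x].

Definition component00 (K : cardinal) (A : set G) : set G :=
  \bigcap_(H in [set H | [/\ is_subgroup H, type_definable A H &
                             bounded_index K H]]) H.

Definition component_infty (K : cardinal) (A : set G) : set G :=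
  \bigcap_(H in [set H | [/\ is_subgroup H, invariant A H &
                             bounded_index K H]]) H.

End Semantics.

Definition elementary_embedding (L : language) (G H : groupType)
    (S : expansion L G) (S' : expansion L H) (e : G -> H) :=
  forall phi : formula L G, sat S id phi <-> sat S' e phi.

Definition monster_model (K : cardinal) (L : language) (G Gs : groupType)
    (S : expansion L G) (Ss : expansion L Gs) (e : G -> Gs) :=
  [/\ elementary_embedding S Ss e, saturated Ss K & strongly_homogeneous Ss K].

Definition type_absolutely_connected (G : groupType) :=
  forall (L : language) (S : expansion L G),
    for_sufficiently_big (fun K =>
      forall (Gs : groupType) (Ss : expansion L Gs) (e : G -> Gs),
        monster_model K S Ss e ->
        component00 Ss K (range e) = [set: Gs]).

Definition homomorphic_image_of (H G : groupType) :=
  exists f : {multiplicative G -> H}, range f = [set: H].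

(* Main.v *)
(* Let [A] be SL2 over the rationals and [X] the free product of copies of    *)
(* [A] indexed by the pairs [(n, g)] with [g] in [G n]. Fix [a0] in [A] which *)
(* is not its own inverse and let [f n] send a reduced word to the product of *)
(* the values of its letters, where the letter [a0] of the copy [(n, g)] has  *)
(* value [g], its inverse has value [g^-1], and all other letters have value  *)
(* [1]. In a product of two reduced words at most one pair of letters is      *)
(* merged without cancelling, so [f n (x * y) = f n x * f n y] for all but    *)
(* one [n]. Put on [X] a predicate for each preimage under [f n] of a subset  *)
(* of [G n]. By compactness the [f n] have standard parts on a monster model  *)
(* [Xs], and these define a homomorphism from [Xs] to the product modulo the  *)
(* direct sum. It is onto by saturation, and its kernel is invariant of       *)
(* bounded index.                                                             *)
(*                                                                            *)
(* The component 00 is everything because [X] is generated by unipotents,     *)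
(* each of which is, for a sequence of diagonal matrices [Y i], a commutator  *)
(* of every [(Y i)^-1 * Y j]: finitely many translates of a definable set [D] *)
(* containing a bounded type-definable subgroup cover [Xs], hence by the      *)
(* pigeonhole principle every conjugate of some [(Y i)^-1 * Y j] is a product *)
(* of four elements of [D] or of its inverse.                                 *)
(*                                                                            *)
(* The component infinity is normal because the index of the normal core of   *)
(* an invariant subgroup of bounded index is bounded by the number of sets of *)
(* pairs of ultrafilters on [X], whatever the saturation of [Xs].             *)
From HB Require Import structures.
From mathcomp Require Import all_boot all_algebra ring.
From mathcomp Require Import finmap all_classical topology.
Require Import Defs.

Set Implicit Arguments.
Unset Strict Implicit.
Unset Printing Implicit Defensive.

Import GRing.Theory Num.Theory.

Local Open Scope classical_set_scope.
Local Open Scope card_scope.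
Local Open Scope group_scope.

(** * Cardinals *)

Lemma card_leTP (S T : Type) (A : set T) :
  [set: S] #<= A <-> exists2 f : S -> T, injective f & forall x, A (f x).
Proof.
split=> [/card_leP[g]|[f finj fA]].
  pose toT (x : S) : [set: S] := exist _ x (mem_set I).
  exists (val \o g \o toT) => [x y /val_inj /(injT (f := g)) [] //|x].
  exact: set_valP.
apply: inj_card_le; apply: unsquash; apply/injfunPex.
by exists f => [x _|x y _ _]; [exact: fA|exact: finj].
Qed.

Lemma inj_card_leT (S T : Type) (f : S -> T) :
  injective f -> [set: S] #<= [set: T].
Proof. by move=> finj; apply/card_leTP; exists f. Qed.

Lemma card_le_rel (S T : Type) (A : set S) (B : set T) (R : S -> T -> Prop) :
  (forall x, A x -> exists2 y, B y & R x y) ->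
  (forall x x' y, A x -> A x' -> R x y -> R x' y -> x = x') -> A #<= B.
Proof.
move=> RAB Rinj; rewrite -(card_le_eql (card_setT A)).
have /choice[f fP] (a : A) : exists y, B y /\ R (val a) y.
  by have [y] := RAB _ (set_valP a); exists y.
apply/card_leTP; exists f => [a b fab|a]; last by case: (fP a).
apply/val_inj/(Rinj _ _ (f a) (set_valP a) (set_valP b)); first by case: (fP a).
by rewrite fab; case: (fP b).
Qed.

Lemma not_card_le_powerset (T : Type) : ~ ([set: set T] #<= [set: T]).
Proof.
move=> /card_leTP[g ginj _]; pose D := [set t | exists2 A, t = g A & ~ A t].
have nD : ~ D (g D) by move=> /[dup] DgD [A /ginj <-].
by apply: (nD); exists D.
Qed.

Lemma maximal_pairwise (T : Type) (R : T -> T -> Prop) : exists2 F : set T,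
  forall s t, F s -> F t -> R s t &
  forall t, R t t -> (forall s, F s -> R s t /\ R t s) -> F t.
Proof.
pose pairwise (F : set T) := forall s t, F s -> F t -> R s t.
have [|F [FR Fmax]] := @Zorn_bigcup _ pairwise.
  move=> C CR Ctot s t [A CA As] [B CB Bt].
  have [AB|BA] := Ctot _ _ CA CB; first by apply: (CR _ CB) => //; exact: AB.
  by apply: (CR _ CA) => //; exact: BA.
exists F => // t Rtt RFt; apply: contrapT => nFt; apply: (Fmax (t |` F)).
  by split; [right|move=> /(_ t (or_introl erefl))].
move=> s s' [->|Fs] [->|Fs'] //.
- exact: (RFt _ Fs').2.
- exact: (RFt _ Fs).1.
- exact: FR.
Qed.

Lemma card_leT_total (T U : Type) :
  [set: T] #<= [set: U] \/ [set: U] #<= [set: T].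
Proof.
have [B Bbij Bmax] :=
  @maximal_pairwise (T * U) (fun p q => p.1 = q.1 <-> p.2 = q.2).
have [Bdom|/existsNP[t tB]] := pselect (forall t, exists u, B (t, u)).
  have [g gB] := choice Bdom; left; apply: (@inj_card_leT _ _ g) => t t'.
  exact: (Bbij _ _ (gB t) (gB t')).2.
have [Bcod|/existsNP[u uB]] := pselect (forall u, exists t, B (t, u)).
  have [g gB] := choice Bcod; right; apply: (@inj_card_leT _ _ g) => u u'.
  exact: (Bbij _ _ (gB u) (gB u')).1.
exfalso; apply: (tB); exists u; apply: Bmax => // -[t' u'] Btu'.
have tt' : t' <> t by move=> tt'; apply: tB; exists u'; rewrite -tt'.
have uu' : u' <> u by move=> uu'; apply: uB; exists t'; rewrite -uu'.
by split; [split=> [/tt'|/uu']|split=> [/esym/tt'|/esym/uu']].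
Qed.

Lemma card_le_total (T U : Type) (A : set T) (B : set U) : A #<= B \/ B #<= A.
Proof.
have := card_leT_total A B.
by rewrite !(card_le_eql (card_setT _)) !(card_le_eqr (card_setT _)).
Qed.

Lemma cofinite_disjoint_sequences (T : Type) :
  exists2 F : set (nat -> T),
    forall f g, F f -> F g -> forall i j, f i = g j -> f = g /\ i = j &
    cofinite_set (\bigcup_(f in F) range f).
Proof.
have [F Fdisj Fmax] := @maximal_pairwise (nat -> T)
  (fun f g => forall i j, f i = g j -> f = g /\ i = j).
exists F => //; apply: contrapT => /infiniteP/card_leTP[h hinj hF].
have Fh f i j : F f -> f i <> h j.
  by move=> Ff fh; apply: (hF j); exists f => //; exists i.
suff Fh0 : F h by exact: (Fh h 0%N 0%N).
apply: Fmax => [i j /hinj//|f Ff].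
by split=> i j => [/(Fh _ _ _ Ff)|/esym/(Fh _ _ _ Ff)].
Qed.

Lemma infinite_card_eq_prod_nat (T : Type) : infinite_set [set: T] ->
  exists U : Type, [set: T] #= [set: U * nat].
Proof.
move=> Tinf; have [F Fdisj Ffin] := cofinite_disjoint_sequences T.
have [f0 Ff0] : F !=set0.
  apply/set0P/eqP => F0; apply: Tinf; move: Ffin.
  by rewrite F0 bigcup_set0 setC0.
have /countable_injP[idx idx_inj] := finite_set_countable Ffin.
exists {f | F f}; apply/card_eqPle; split; last first.
  apply: (@inj_card_leT _ _ (fun p => sval p.1 p.2)) => -[[f Ff] i] [[g Fg] j].
  by move=> /= /(Fdisj _ _ Ff Fg)[fg ->]; congr (_, _); exact: eq_exist.
pose code x (p : {f | F f} * nat) :=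
  (exists2 i, x = sval p.1 i & p.2 = i.*2) \/
  (x \in ~` \bigcup_(f in F) range f) /\ p.2 = (idx x).*2.+1.
apply: (@card_le_rel _ _ _ _ code) => [x _|x y p _ _].
  have [[f Ff [i _ fi]]|nFx] := pselect ((\bigcup_(f in F) range f) x).
    by exists (exist _ f Ff, i.*2) => //; left; exists i.
  by exists (exist _ f0 Ff0, (idx x).*2.+1) => //; right; rewrite inE.
move=> [[i -> pi]|[xF px]] [[j -> pj]|[yF py]].
- by rewrite (double_inj (etrans (esym pi) pj)).
- by move: (congr1 odd py); rewrite pi /= !odd_double.
- by move: (congr1 odd px); rewrite pj /= !odd_double.
- by apply: idx_inj => //; apply: double_inj; rewrite px in py; case: py.
Qed.

Lemma infinite_card_addT (T : Type) :
  infinite_set [set: T] -> [set: T + T] #<= [set: T].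
Proof.
move=> /infinite_card_eq_prod_nat[U /card_eqPle[TU UT]].
apply: card_le_trans UT; case/card_leTP: TU => f finj _.
pose code s := match s with
  | inl x => ((f x).1, (f x).2.*2)
  | inr x => ((f x).1, (f x).2.*2.+1)
  end.
have f_eq x y : (f x).1 = (f y).1 -> (f x).2.*2 = (f y).2.*2 -> x = y.
  by move=> xy1 /double_inj xy2; apply/finj/injective_projections.
apply: (@inj_card_leT _ _ code) => -[x|x] [y|y] /= [xy1 xy2].
- by rewrite (f_eq x y).
- by move: (congr1 odd xy2); rewrite /= !odd_double.
- by move: (congr1 odd xy2); rewrite /= !odd_double.
- by rewrite (f_eq x y).
Qed.

Lemma small_le (K : cardinal) (S T : Type) (A : set S) (B : set T) :
  A #<= B -> small K B -> small K A.
Proof. by move=> AB sB KA; apply: sB; exact: card_le_trans KA AB. Qed.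

Lemma small_powerset_le (K : cardinal) (S T : Type) (A : set S) :
  A #<= [set: T] -> [set: set T] #<= [set: K] -> small K A.
Proof.
move=> AT TK KA; apply: (@not_card_le_powerset T).
exact: card_le_trans (card_le_trans TK KA) AT.
Qed.

Lemma small_finite (K : cardinal) (T : Type) (A : set T) :
  infinite_set [set: K] -> finite_set A -> small K A.
Proof. by move=> Kinf Afin /card_le_finite/(_ Afin). Qed.

Lemma small_setU (K : cardinal) (T : Type) (A B : set T) :
  infinite_set [set: K] -> small K A -> small K B -> small K (A `|` B).
Proof.
move=> Kinf; wlog AB : A B / A #<= B => [hwlog|_ sB KAB].
  have [AB|BA] := card_le_total A B; first exact: hwlog.
  by move=> sA sB; rewrite setUC; exact: hwlog.
have Binf : infinite_set [set: B].
  rewrite (eq_finite_set (card_setT B)) => Bfin.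
  apply: Kinf; apply: card_le_finite KAB _; rewrite finite_setU; split=> //.
  exact: card_le_finite AB Bfin.
apply: sB; apply: card_le_trans KAB _.
rewrite -(card_le_eqr (card_setT B)).
apply: card_le_trans (infinite_card_addT Binf).
move: AB; rewrite -(card_le_eql (card_setT A)) -(card_le_eqr (card_setT B)).
move=> /card_leTP[g ginj _].
pose code x (s : B + B) := match s with
  | inl b => exists2 a : A, x = val a & b = g a
  | inr b => x = val b
  end.
apply: (@card_le_rel _ _ _ _ code) => [x|x y [b|b] _ _] /=.
- move=> [Ax|Bx]; last by exists (inr (SigSub (mem_set Bx))).
  by exists (inl (g (SigSub (mem_set Ax)))) => //; exists (SigSub (mem_set Ax)).
- by move=> [a -> ->] [a' -> /ginj->].
- by move=> -> ->.
Qed.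

Lemma for_sufficiently_big_ge (T : cardinal) :
  for_sufficiently_big (fun K => [set: T] #<= [set: K]).
Proof. by exists T. Qed.

Lemma for_sufficiently_big_infinite :
  for_sufficiently_big (fun K => infinite_set [set: K]).
Proof. by exists nat => K /infiniteP. Qed.

Lemma for_sufficiently_bigI (P Q : cardinal -> Prop) :
  for_sufficiently_big P -> for_sufficiently_big Q ->
  for_sufficiently_big (fun K => P K /\ Q K).
Proof.
move=> [T TP] [U UQ]; exists (T + U)%type => K TUK; split.
  by apply/TP/(card_le_trans _ TUK)/(@inj_card_leT _ _ inl) => x y [].
by apply/UQ/(card_le_trans _ TUK)/(@inj_card_leT _ _ inr) => x y [].
Qed.

Lemma for_sufficiently_bigS (P Q : cardinal -> Prop) :
  (forall K, P K -> Q K) -> for_sufficiently_big P -> for_sufficiently_big Q.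
Proof. by move=> PQ [T TP]; exists T => K /TP/PQ. Qed.

(** * Groups *)

Section MorphM.
Variables (G H : groupType) (f : G -> H).
Hypothesis fM : {morph f : x y / x * y}.

Lemma morphM1 : f 1 = 1.
Proof. by apply: (@mulgI _ (f 1)); rewrite -fM !mulg1. Qed.

Let fmorph : UMagmaMorphism.type G H :=
  HB.pack f (isMultiplicative.Build G H f fM)
    (Multiplicative_isUMagmaMorphism.Build G H f morphM1).

Lemma morphMV : {morph f : x / x^-1}.
Proof. exact: (gmulfV fmorph). Qed.

Lemma morphMJ : {morph f : x y / x ^ y}.
Proof. exact: (gmulfJ fmorph). Qed.

Lemma morphMR : {morph f : x y / [~ x, y]}.
Proof. exact: (gmulfR fmorph). Qed.

Lemma preimage_subgroup (K : set H) : is_subgroup K -> is_subgroup (f @^-1` K).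
Proof.
move=> [K1 KM KV]; split=> /= [|x y|x]; rewrite ?morphM1 ?fM ?morphMV //.
  exact: KM.
exact: KV.
Qed.

Lemma morphM_eq x y : f x = f y <-> f (x^-1 * y) = 1.
Proof.
rewrite fM morphMV; split=> [->|xy]; first exact: mulVg.
by apply: (@mulgI _ (f x)^-1); rewrite mulVg xy.
Qed.

End MorphM.

Lemma commg_eq (G : groupType) (x y z : G) : y * x * z = x * y -> z = [~ x, y].
Proof.
move=> xyz; apply: (mulgI (y * x)); rewrite xyz.
by rewrite commgEl conjgE !mulgA mulgK mulgV mul1g.
Qed.

Section Cosets.
Variables (G : groupType) (H : set G).
Hypothesis sgH : is_subgroup H.

Lemma coset_sym x y : H (x^-1 * y) -> H (y^-1 * x).
Proof. by case: sgH => _ _ HV /HV; rewrite invgM invgK. Qed.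

Lemma coset_trans y x z : H (x^-1 * y) -> H (y^-1 * z) -> H (x^-1 * z).
Proof. by case: sgH => _ HM _ xy /(HM _ _ xy); rewrite mulgA mulgK. Qed.

Lemma left_coset_eq x y : left_coset H x = left_coset H y <-> H (x^-1 * y).
Proof.
have left_cosetE t z : left_coset H t z <-> H (t^-1 * z).
  split=> [[h Hh <-]|Htz]; first by rewrite mulKg.
  by exists (t^-1 * z); rewrite ?mulVKg.
split=> [xy|xy].
  by apply/left_cosetE; rewrite xy; apply/left_cosetE; rewrite mulVg; case: sgH.
apply/seteqP; split=> z; rewrite !left_cosetE; apply: coset_trans => //.
exact: coset_sym.
Qed.

Lemma card_left_cosets_le (T : Type) (f : G -> T) :
  (forall x y, f x = f y -> H (x^-1 * y)) ->
  range (left_coset H) #<= [set: T].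
Proof.
move=> fH; pose value C t := exists x, C = left_coset H x /\ t = f x.
apply: (@card_le_rel _ _ _ _ value) => [_ [x _ <-]|].
  by exists (f x); last exists x.
by move=> _ _ _ _ _ [x [-> ->]] [y [-> /fH/left_coset_eq]].
Qed.

Lemma bounded_index_transversal (K : cardinal) : bounded_index K H ->
  exists2 C : set G, small K C & forall x, exists2 c, C c & H (c^-1 * x).
Proof.
move=> Hbd; have /choice[rep repP] (c : set G) :
    exists x, range (left_coset H) c -> c = left_coset H x.
  have [[x _ <-]|nc] := pselect (range (left_coset H) c); first by exists x.
  by exists 1.
exists (rep @` range (left_coset H)).
  exact: small_le (card_image_le _ _) Hbd.
move=> x; exists (rep (left_coset H x)); first by do 2!eexists.
by apply/left_coset_eq; apply/esym/repP; exists x.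
Qed.

End Cosets.

Definition conj_core (G : groupType) (H : set G) : set G :=
  [set x | forall g, H (x ^ g)].

Lemma conj_core_subgroup (G : groupType) (H : set G) :
  is_subgroup H -> is_subgroup (conj_core H).
Proof.
move=> [H1 HM HV]; split=> [g|x y Hx Hy g|x Hx g].
- by rewrite conj1g.
- by rewrite conjMg; exact: HM.
- by rewrite conjVg; exact: HV.
Qed.

Section QuotientGroupTheory.
Variables (G : groupType) (N H : set G) (nNH : is_normal_in N H).

Definition coset_class x (Hx : H x) : quotient_group nNH :=
  exist _ (left_coset N x) (ex_intro2 _ _ x Hx erefl).

Lemma coset_class_surj (C : quotient_group nNH) :
  exists x (Hx : H x), C = coset_class Hx.
Proof. by case: C => C [x Hx Cx]; exists x, Hx; exact: eq_exist. Qed.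

Lemma coset_classM x y (Hx : H x) (Hy : H y) (Hxy : H (x * y)) :
  coset_class Hxy = coset_class Hx * coset_class Hy.
Proof. by apply: eq_exist; rewrite /= -(mul_left_coset nNH). Qed.

Lemma coset_class_eq x y (Hx : H x) (Hy : H y) :
  coset_class Hx = coset_class Hy <-> N (x^-1 * y).
Proof.
have sgN : is_subgroup N by case: nNH.
rewrite -(left_coset_eq sgN x y); split=> [/(congr1 (@sval _ _))//|xy].
exact: eq_exist.
Qed.

Lemma homomorphic_image_quotient (Q : groupType) (f : G -> Q) :
  {morph f : x y / x * y} -> (forall x, N x -> f x = 1) ->
  f @` H = [set: Q] -> homomorphic_image_of Q (quotient_group nNH).
Proof.
move=> fM fN fH; have /choice[rep repP] := coset_class_surj.
have f_rep x (Hx : H x) : f (rep (coset_class Hx)) = f x.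
  have [Hr /esym/coset_class_eq rx] := repP (coset_class Hx).
  by apply/(morphM_eq fM)/fN.
have f_repM : {morph f \o rep : C D / C * D}.
  move=> C D /=; have [x [Hx ->]] := coset_class_surj C.
  have [y [Hy ->]] := coset_class_surj D.
  have Hxy : H (x * y) by case: nNH => -[_ HM _] _ _ _; exact: HM.
  by rewrite -(coset_classM Hx Hy Hxy) !f_rep fM.
exists (HB.pack_for {multiplicative quotient_group nNH -> Q} (f \o rep)
  (isMultiplicative.Build (quotient_group nNH) Q (f \o rep) f_repM)).
rewrite eqEsubset; split=> // q _.
have [x Hx <-] : (f @` H) q by rewrite fH.
by exists (coset_class Hx) => //; exact: f_rep.
Qed.

End QuotientGroupTheory.

Lemma homomorphic_image_abelian (G H : groupType) :
  homomorphic_image_of H G -> abelian_group G -> abelian_group H.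
Proof.
move=> [f frange] Gab x y.
have [[a _ <-] [b _ <-]] : range f x /\ range f y by rewrite frange.
exact/gmulf_commute/Gab.
Qed.

Section ProductModSum.
Variables (I : Type) (G : I -> groupType).

Definition product_mod_sum : groupType := quotient_group (direct_sum_normal G).

Definition product_class (g : product_group G) : product_mod_sum :=
  coset_class (direct_sum_normal G) (Logic.I : [set: product_group G] g).

Lemma product_classM : {morph product_class : g h / g * h}.
Proof. by move=> g h; exact: coset_classM. Qed.

Lemma product_class_surj (c : product_mod_sum) : exists g, product_class g = c.
Proof.
have [g [gT ->]] := coset_class_surj c; exists g.
by apply/coset_class_eq; rewrite mulVg; case: (direct_sum_normal G) => _ [].
Qed.

Lemma product_class_eq (g h : product_group G) :
  product_class g = product_class h <-> finite_set [set i | g i <> h i].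
Proof.
rewrite coset_class_eq; suff -> : [set i | g i <> h i] =
  [set i | (g i)^-1 * h i <> 1] by [].
apply/seteqP; split=> i /=; apply: contra_not; last by move=> ->; rewrite mulVg.
by move=> gh; apply: (@mulgI _ (g i)^-1); rewrite mulVg gh.
Qed.

Lemma product_mod_sum_nonabelian :
  infinite_set [set i | ~ abelian_group (G i)] ->
  ~ abelian_group product_mod_sum.
Proof.
move=> Ginf Gab; apply: Ginf.
have noncommuting i : exists p : G i * G i,
    ~ abelian_group (G i) -> p.1 * p.2 <> p.2 * p.1.
  have [ab|/existsNP[x /existsNP[y xy]]] := pselect (abelian_group (G i)).
    by exists (1, 1).
  by exists (x, y).
pose x : product_group G := fun i => (sval (cid (noncommuting i))).1.
pose y : product_group G := fun i => (sval (cid (noncommuting i))).2.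
have /product_class_eq : product_class (x * y) = product_class (y * x).
  by rewrite !product_classM; exact: Gab.
by apply: sub_finite_set => i; exact: (svalP (cid (noncommuting i))).
Qed.

End ProductModSum.

(** * Definable sets and saturation *)

Section Substitution.
Variable L : language.

Fixpoint tsubst (V W : Type) (s : V -> term L W) (t : term L V) : term L W :=
  match t with
  | TVar x => s x
  | TOne => TOne L W
  | TInv t => TInv (tsubst s t)
  | TMul t u => TMul (tsubst s t) (tsubst s u)
  | TFun f ts => TFun (fun i => tsubst s (ts i))
  end.

Definition lift_subst (V W : Type) (s : V -> term L W) (x : option V) :
    term L (option W) :=
  if x is Some y then tsubst (fun z => TVar L (Some z)) (s y) else TVar L None.

Fixpoint fsubst (V W : Type) (s : V -> term L W) (phi : formula L V) :
    formula L W :=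
  match phi with
  | FFalse => FFalse L W
  | FEq t u => FEq (tsubst s t) (tsubst s u)
  | FRel r ts => FRel (fun i => tsubst s (ts i))
  | FImp phi psi => FImp (fsubst s phi) (fsubst s psi)
  | FAll phi => FAll (fsubst (lift_subst s) phi)
  end.

Definition frename (V W : Type) (r : V -> W) (phi : formula L V) :
    formula L W :=
  fsubst (fun x => TVar L (r x)) phi.

Definition FNot (V : Type) (phi : formula L V) : formula L V :=
  FImp phi (FFalse L V).

Definition FAnd (V : Type) (phi psi : formula L V) : formula L V :=
  FNot (FImp phi (FNot psi)).

Definition FEx (V : Type) (phi : formula L (option V)) : formula L V :=
  FNot (FAll (FNot phi)).

Variables (G : groupType) (S : expansion L G).

Lemma eval_tsubst (V W : Type) (s : V -> term L W) (t : term L V) (v : W -> G) :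
  eval S v (tsubst s t) = eval S (eval S v \o s) t.
Proof.
elim: t => //= [t ->|t -> u ->|f ts IH] //.
by congr fun_interp; apply/funext => i; exact: IH.
Qed.

Lemma sat_fsubst (V W : Type) (s : V -> term L W) (phi : formula L V)
    (v : W -> G) :
  sat S v (fsubst s phi) <-> sat S (eval S v \o s) phi.
Proof.
elim: phi W s v => //= {V} V.
- by move=> t u W s v; rewrite !eval_tsubst.
- move=> r ts W s v; suff -> : (fun i => eval S v (tsubst s (ts i))) =
    (fun i => eval S (eval S v \o s) (ts i)) by [].
  by apply/funext => i; rewrite eval_tsubst.
- by move=> phi IHphi psi IHpsi W s v; rewrite IHphi IHpsi.
- move=> phi IH W s v; split=> phiv x; have := phiv x; rewrite IH;
    suff -> : eval S (oapp v x) \o lift_subst s = oapp (eval S v \o s) x by [];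
    by apply/funext => -[y|] //=; rewrite eval_tsubst.
Qed.

Lemma sat_frename (V W : Type) (r : V -> W) (phi : formula L V) (v : W -> G) :
  sat S v (frename r phi) <-> sat S (v \o r) phi.
Proof. exact: sat_fsubst. Qed.

Lemma sat_FAnd (V : Type) (v : V -> G) phi psi :
  sat S v (FAnd phi psi) <-> sat S v phi /\ sat S v psi.
Proof.
split=> /= [nimp|[phiv psiv]]; last by apply.
by apply: contrapT => /not_andP nand; apply: nimp => phiv psiv; case: nand.
Qed.

Lemma sat_FEx (V : Type) (v : V -> G) phi :
  sat S v (FEx phi) <-> exists x, sat S (oapp v x) phi.
Proof.
split=> /= [nall|[x phix]]; last by move=> /(_ x phix).
by apply: contrapT => nex; apply: nall => x phix; apply: nex; exists x.
Qed.

End Substitution.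

Section Definability.
Variables (L : language) (G : groupType) (S : expansion L G).

Definition definable (A D : set G) :=
  exists phi : formula L (option A), forall x, D x <-> sat S (oapp val x) phi.

Definition definable2 (A : set G) (R : G -> G -> Prop) :=
  exists phi : formula L (option (option A)),
    forall x y, R x y <-> sat S (oapp (oapp val x) y) phi.

Implicit Types (A B D E : set G) (R : G -> G -> Prop).

Lemma definable_comp A D (t : term L (option A)) :
  definable A D -> definable A [set x | D (eval S (oapp val x) t)].
Proof.
move=> [phi Dphi].
pose s (z : option A) := if z is Some a then TVar L (Some a) else t.
exists (fsubst s phi) => x; rewrite sat_fsubst /mkset Dphi.
suff -> : eval S (oapp val x) \o s = oapp val (eval S (oapp val x) t) by [].
by apply/funext => -[].
Qed.

Lemma definable_translate A D g :
  A g -> definable A D -> definable A [set x | D (g^-1 * x)].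
Proof.
move=> Ag; pose a : A := exist _ g (mem_set Ag).
exact: (@definable_comp A D (TMul (TInv (TVar L (Some a))) (TVar L None))).
Qed.

Lemma definableI A D E :
  definable A D -> definable A E -> definable A (D `&` E).
Proof.
move=> [phi Dphi] [psi Epsi]; exists (FAnd phi psi) => x.
by rewrite sat_FAnd -Dphi -Epsi.
Qed.

Lemma definableC A D : definable A D -> definable A (~` D).
Proof. by move=> [phi Dphi]; exists (FNot phi) => x /=; rewrite -Dphi. Qed.

Lemma definableT A : definable A setT.
Proof. by exists (FNot (FFalse _ _)) => x; split=> // _ []. Qed.

Lemma definable2I A R R' : definable2 A R -> definable2 A R' ->
  definable2 A (fun x y => R x y /\ R' x y).
Proof.
move=> [phi Rphi] [psi Rpsi]; exists (FAnd phi psi) => x y.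
by rewrite sat_FAnd -Rphi -Rpsi.
Qed.

Lemma definable2C A R : definable2 A R -> definable2 A (fun x y => ~ R x y).
Proof. by move=> [phi Rphi]; exists (FNot phi) => x y /=; rewrite -Rphi. Qed.

Lemma definable2T A : definable2 A (fun _ _ => True).
Proof. by exists (FNot (FFalse _ _)) => x y; split=> // _ []. Qed.

Lemma definable2_comp A D (t : term L (option (option A))) : definable A D ->
  definable2 A (fun x y => D (eval S (oapp (oapp val x) y) t)).
Proof.
move=> [phi Dphi].
pose s (z : option A) := if z is Some a then TVar L (Some (Some a)) else t.
exists (fsubst s phi) => x y; rewrite sat_fsubst Dphi.
suff -> : eval S (oapp (oapp val x) y) \o s =
  oapp val (eval S (oapp (oapp val x) y) t) by [].
by apply/funext => -[].
Qed.

Lemma definable2_fst A D : definable A D -> definable2 A (fun x _ => D x).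
Proof. exact: (@definable2_comp A D (TVar L (Some None))). Qed.

Lemma definable2_snd A D : definable A D -> definable2 A (fun _ y => D y).
Proof. exact: (@definable2_comp A D (TVar L None)). Qed.

Lemma definable2_mul A D : definable A D -> definable2 A (fun x y => D (x * y)).
Proof.
exact: (@definable2_comp A D (TMul (TVar L (Some None)) (TVar L None))).
Qed.

Lemma definable_exists A R :
  definable2 A R -> definable A [set x | exists y, R x y].
Proof.
move=> [phi Rphi]; exists (FEx phi) => x; rewrite sat_FEx.
by split=> -[y] /Rphi; exists y.
Qed.

Lemma definable_fiberl A B R c : A `<=` B -> B c ->
  definable2 A R -> definable B (R c).
Proof.
move=> AB Bc [phi Rphi].
pose inB (z : option A) : B := if z is Some a
  then SigSub (mem_set (AB _ (set_valP a))) else SigSub (mem_set Bc).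
exists (frename (omap inB) phi) => y; rewrite sat_frename Rphi.
suff -> : oapp val y \o omap inB = oapp (oapp val c) y by [].
by apply/funext => -[[]|].
Qed.

Lemma definable2_swap A R : definable2 A R -> definable2 A (fun x y => R y x).
Proof.
move=> [phi Rphi].
pose swap (z : option (option A)) := match z with
  | Some (Some a) => Some (Some a)
  | Some None => None
  | None => Some None
  end.
exists (frename swap phi) => x y; rewrite sat_frename Rphi.
suff -> : oapp (oapp val x) y \o swap = oapp (oapp val y) x by [].
by apply/funext => -[[]|].
Qed.

Lemma definable_fiberr A B R c : A `<=` B -> B c ->
  definable2 A R -> definable B (R ^~ c).
Proof. by move=> AB Bc /definable2_swap; exact: definable_fiberl. Qed.

Lemma definableS A B D : A `<=` B -> definable A D -> definable B D.
Proof.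
move=> AB [phi Dphi].
pose inB (a : A) : B := SigSub (mem_set (AB _ (set_valP a))).
exists (frename (omap inB) phi) => x; rewrite sat_frename Dphi.
suff -> : oapp val x \o omap inB = oapp val x by [].
by apply/funext => -[].
Qed.

Lemma type_definableP A H : type_definable S A H <->
  forall x, (forall D, definable A D -> H `<=` D -> D x) -> H x.
Proof.
split=> [[p ->] x Hx phi pphi|Hdef].
  apply: (Hx [set y | sat S (oapp val y) phi]); first by exists phi.
  by move=> y; exact.
exists [set phi | forall y, H y -> sat S (oapp val y) phi].
apply/seteqP; split=> [x Hx phi|x xp]; first exact.
by apply: Hdef => D [phi Dphi] HD; apply/Dphi/xp => y /HD/Dphi.
Qed.

Lemma type_definableS A B H :
  A `<=` B -> type_definable S A H -> type_definable S B H.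
Proof.
move=> AB /type_definableP Hdef; apply/type_definableP => x Hx.
by apply: Hdef => D /(definableS AB); exact: Hx.
Qed.

Definition realizes_over (A : set G) (F : set_system G) (x : G) :=
  forall D, definable A D -> F D -> D x.

Lemma realizes_overS A B F x :
  A `<=` B -> realizes_over B F x -> realizes_over A F x.
Proof. by move=> AB Fx D /(definableS AB); exact: Fx. Qed.

Section Saturated.
Variable K : cardinal.
Hypothesis sat_S : saturated S K.

Lemma saturated_filter A (F : set_system G) : ProperFilter F -> small K A ->
  exists x, realizes_over A F x.
Proof.
move=> FF sA; pose p : set (formula L (option A)) :=
  [set phi | F [set x | sat S (oapp val x) phi]].
have [|x px] := sat_S sA (p := p); last first.
  exists x => D [phi Dphi] FD; apply/Dphi/px.
  by apply: filterS FD => y /Dphi.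
move=> q /(@finite_seqP {classic (formula L (option A))})[s ->] sp.
suff : F [set x | realizes S [set` s] x] by move=> /filter_ex.
elim: s sp => [|phi s IH] sp; first by apply: filterS filterT.
have /IH Fs : [set` s] `<=` p.
  by move=> psi spsi; apply: sp => /=; rewrite inE spsi orbT.
have Fphi : p phi by apply: sp; exact: mem_head.
apply: filterS (filterI Fphi Fs) => x [xphi xs] psi /=.
by rewrite inE => /orP[/eqP->//|/xs].
Qed.

Lemma saturated_filter2 A (F : set_system (G * G)) : ProperFilter F ->
  (forall x, small K (x |` A)) ->
  exists x y, forall R, definable2 A R -> F [set p | R p.1 p.2] -> R x y.
Proof.
move=> FF sA1; have sA : small K A.
  by apply: small_le (sA1 1); apply: subset_card_le => x; right.
have [x xF] := saturated_filter (fmap_proper_filter fst FF) sA.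
pose in_F : set (G -> G -> Prop) :=
  [set R | definable2 A R /\ F [set p | R p.1 p.2]].
have fibersF : ProperFilter (filter_from in_F (fun R => R x)).
  apply: filter_from_proper => [|R [Rdef FR]].
    apply: filter_from_filter => [|R R' [Rdef FR] [R'def FR']].
      exists (fun _ _ => True).
      by split; [exact: definable2T|exact: filterT].
    exists (fun y z => R y z /\ R' y z) => //.
    by split; [exact: definable2I|exact: filterI].
  apply: (xF _ (definable_exists Rdef)); rewrite fmapE.
  by apply: filterS FR => -[y z] Ryz; exists z.
have [y yF] := saturated_filter fibersF (sA1 x).
exists x, y => R Rdef FR; apply: yF; last by exists R.
by apply: definable_fiberl Rdef => [a Aa|]; [right|left].
Qed.

End Saturated.

End Definability.

(** * Elementary embeddings *)

Lemma fmap_ultra (T T' : Type) (f : T -> T') (F : set_system T) :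
  UltraFilter F -> UltraFilter (f @ F).
Proof.
move=> FU; split=> [|G GF FG]; first exact: fmap_proper_filter.
apply/seteqP; split=> // A GA.
have [//|FC] := in_ultra_setVsetC (f @^-1` A) FU.
by have [y []] := filter_ex (filterI GA (FG (~` A) FC)).
Qed.

Section ElementaryEmbedding.
Variables (L : language) (X Xs : groupType).
Variables (S : expansion L X) (Ss : expansion L Xs) (e : X -> Xs).
Hypothesis emb : elementary_embedding S Ss e.

Lemma embM : {morph e : x y / x * y}.
Proof.
move=> x y.
exact: ((emb (FEq (TVar L (x * y)) (TMul (TVar L x) (TVar L y)))).1 erefl).
Qed.

Lemma emb_sat V (v : V -> X) (phi : formula L V) :
  sat S v phi <-> sat Ss (e \o v) phi.
Proof. by have := emb (frename v phi); rewrite !sat_frename. Qed.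

Lemma definable_emb_nonempty D :
  definable Ss (range e) D -> D !=set0 -> exists m, D (e m).
Proof.
move=> [phi Dphi] [y /Dphi phiy].
have /choice[r er] (a : range e) : exists x, e x = val a.
  by case: (set_valP a) => x _ <-; exists x.
pose psi := frename (omap r) phi.
have psiE z : sat Ss (oapp e z) psi <-> D z.
  rewrite sat_frename Dphi.
  by suff -> : oapp e z \o omap r = oapp val z by []; apply/funext => -[a|] //=.
have /(emb (FEx psi)).2/sat_FEx[m] : sat Ss e (FEx psi).
  by apply/sat_FEx; exists y; apply/psiE/Dphi.
rewrite emb_sat; have -> : e \o oapp id m = oapp e (e m) by apply/funext => -[].
by rewrite psiE; exists m.
Qed.

Lemma definable2_emb_nonempty R : definable2 Ss (range e) R ->
  (exists x y, R x y) -> exists p : X * X, R (e p.1) (e p.2).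
Proof.
move=> Rdef /(definable_emb_nonempty (definable_exists Rdef))[m mR].
have Rm : definable Ss (range e) (R (e m)).
  by apply: definable_fiberl Rdef => //; exists m.
by have [n] := definable_emb_nonempty Rm mR; exists (m, n).
Qed.

Definition coheir (B : set Xs) (U : set_system X) := realizes_over Ss B (e @ U).

Lemma coheirP B (U : set_system X) x D : UltraFilter U -> coheir B U x ->
  definable Ss B D -> D x <-> U (e @^-1` D).
Proof.
move=> UU Ux dD; split=> [Dx|]; last exact: Ux.
have [//|UC] := in_ultra_setVsetC (e @^-1` D) UU.
by have := Ux _ (definableC dD) UC.
Qed.

Definition coheir2 (W : set_system (X * X)) (x y : Xs) :=
  forall R, definable2 Ss (range e) R ->
    W [set p | R (e p.1) (e p.2)] <-> R x y.

Lemma coheir2_exists x y : exists2 W, UltraFilter W & coheir2 W x y.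
Proof.
pose type_xy := [set R | definable2 Ss (range e) R /\ R x y].
have typeF :
    ProperFilter (filter_from type_xy (fun R => [set p | R (e p.1) (e p.2)])).
  apply: filter_from_proper => [|R [Rdef Rxy]]; last first.
    by apply: definable2_emb_nonempty => //; exists x, y.
  apply: filter_from_filter => [|R R' [Rdef Rxy] [R'def R'xy]].
    by exists (fun _ _ => True); split=> //; exact: definable2T.
  exists (fun z w => R z w /\ R' z w) => //.
  by split=> //; exact: definable2I.
have [W [WU typeW]] := ultraFilterLemma typeF.
exists W => // R Rdef; split=> [WR|Rxy]; last by apply: typeW; exists R.
apply: contrapT => nRxy; have WC : W [set p | ~ R (e p.1) (e p.2)].
  apply: typeW; exists (fun z w => ~ R z w) => //.
  by split=> //; exact: definable2C.
by have [p []] := filter_ex (filterI WR WC).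
Qed.

Lemma coheir_exists x : exists2 U, UltraFilter U & coheir (range e) U x.
Proof.
have [W WU Wx] := coheir2_exists x x; exists (fst @ W); first exact: fmap_ultra.
by move=> D Ddef WD; apply/(Wx (fun z _ => D z)) => //; exact: definable2_fst.
Qed.

End ElementaryEmbedding.

(** * A criterion for type-absolute connectedness *)

Lemma nat_finType_collision (T : finType) (c : nat -> T) :
  exists i j, i != j /\ c i = c j.
Proof.
apply: contrapT => ncol; apply: infinite_nat.
apply: (card_le_finite (B := [set: T])); last exact: finite_finset.
apply: (@inj_card_leT _ _ c) => i j cij; apply: contrapT => /eqP ij.
by apply: ncol; exists i, j.
Qed.

Definition left_generic (G : groupType) (E : set G) :=
  exists s : seq G, forall x, exists2 g, g \in s & E (g^-1 * x).

(* Color [i] by the map sending each of the finitely many [g] in [s] to an    *)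
(* [h] in [s] such that the conjugate of [Y i] by [g] is in [h * E].          *)
Lemma left_generic_conj (G : groupType) (E : set G) (Y : nat -> G) :
  left_generic E -> exists i j, i != j /\
    forall x, exists u v w, [/\ E u, E v, E w &
      ((Y i)^-1 * Y j) ^ x = (v * u)^-1 * (w * u)].
Proof.
move=> [s sE]; have /choice[color colorE] i :
    exists c : {ffun seq_sub s -> seq_sub s},
      forall g, E ((val (c g))^-1 * Y i ^ val g).
  have /choice[c cE] (g : seq_sub s) :
      exists h : seq_sub s, E ((val h)^-1 * Y i ^ val g).
    by have [h hs Eh] := sE (Y i ^ val g); exists (SeqSub hs).
  by exists (finfun c) => g; rewrite ffunE.
have [i [j [ij cij]]] := nat_finType_collision color.
exists i, j; split=> // x; have [g gs Eu] := sE x.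
exists (g^-1 * x), ((val (color i (SeqSub gs)))^-1 * Y i ^ g).
exists ((val (color i (SeqSub gs)))^-1 * Y j ^ g); split=> //.
  by rewrite cij; exact: (colorE j (SeqSub gs)).
have -> : ((Y i)^-1 * Y j) ^ x = ((Y i ^ g)^-1 * Y j ^ g) ^ (g^-1 * x).
  by rewrite -conjVg -conjMg -conjgM mulVKg.
move: (g^-1 * x) (val (color i _)) => u h.
by rewrite conjgE !(invgM, invgK, mulgA, mulgK).
Qed.

Definition infinitely_commutator (G : groupType) (z : G) :=
  exists Y : nat -> G, forall i j, i != j ->
    exists w, z = [~ (Y i)^-1 * Y j, w].

Lemma infinitely_commutator_morph (G H : groupType) (f : G -> H) z :
  {morph f : x y / x * y} ->
  infinitely_commutator z -> infinitely_commutator (f z).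
Proof.
move=> fM [Y zY]; exists (f \o Y) => i j /zY[w ->]; exists (f w).
by rewrite (morphMR fM) fM (morphMV fM).
Qed.

Definition definable_nbhd (L : language) (G : groupType) (S : expansion L G)
    (A H D : set G) :=
  definable S A D /\ H `<=` D.

Section BoundedTypeDefinable.
Variables (L : language) (G : groupType) (S : expansion L G) (K : cardinal).
Hypotheses (Kinf : infinite_set [set: K]) (sat_S : saturated S K).
Variables A H : set G.
Hypotheses (sA : small K A) (sgH : is_subgroup H) (Hdef : type_definable S A H).
Hypothesis Hbd : bounded_index K H.

Local Notation nbhd := (definable_nbhd S A H).

Let nbhdI D E : nbhd D -> nbhd E -> nbhd (D `&` E).
Proof.
move=> [dD HD] [dE HE]; split; first exact: definableI.
by move=> x Hx; split; [exact: HD|exact: HE].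
Qed.

Let nbhd_filter T (B : set G -> set T) :
  (forall D E, B (D `&` E) `<=` B D `&` B E) ->
  (forall D, nbhd D -> B D !=set0) ->
  ProperFilter (filter_from nbhd B).
Proof.
move=> BI B0; apply: filter_from_proper => //; apply: filter_from_filter.
  by exists setT; split=> //; exact: definableT.
by move=> D E nD nE; exists (D `&` E) => //; exact: nbhdI.
Qed.

Lemma definable_nbhd_mul D : nbhd D ->
  exists2 E, nbhd E & forall x y, E x -> E y -> D (x * y).
Proof.
move=> [dD HD]; apply: contrapT => nE.
pose bad E := [set p : G * G | [/\ E p.1, E p.2 & ~ D (p.1 * p.2)]].
have badF : ProperFilter (filter_from nbhd bad).
  apply: nbhd_filter => [E E' p [[? ?] [? ?] ?]//|E nbE].
  apply/set0P/eqP => bad0; apply: nE; exists E => // x y Ex Ey.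
  apply: contrapT => nDxy; suff : bad E (x, y) by rewrite bad0.
  by split.
have sA1 x : small K (x |` A).
  exact/(small_setU Kinf)/sA/(small_finite Kinf)/finite_set1.
have [x [y xy]] := saturated_filter2 sat_S badF sA1.
have Hx : H x.
  apply/(type_definableP S A H).1 => // E dE HE.
  by apply: (xy (fun x _ => E x) (definable2_fst dE)); exists E => // p [].
have Hy : H y.
  apply/(type_definableP S A H).1 => // E dE HE.
  by apply: (xy (fun _ y => E y) (definable2_snd dE)); exists E => // p [].
apply: (xy _ (definable2C (definable2_mul dD))); last first.
  by apply: HD; case: sgH => _ HM _; exact: HM.
by exists D => // p [].
Qed.

Lemma definable_nbhd_halve D : nbhd D ->
  exists E, [/\ nbhd E, forall x, E x -> E x^-1 &
    forall x y, E x -> E y -> D (x * y)].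
Proof.
move=> /definable_nbhd_mul[E [dE HE] ED].
exists (E `&` [set x | E x^-1]); split=> [|x|x y] /=; last first.
- by move=> [Ex _] [Ey _]; exact: ED.
- by rewrite invgK => -[].
apply: nbhdI; split=> //.
  exact: (@definable_comp _ _ _ _ _ (TInv (TVar L None))).
by move=> x Hx; apply: HE; case: sgH => _ _ HV; exact: HV.
Qed.

Lemma definable_nbhd_left_generic D : nbhd D -> left_generic D.
Proof.
move=> [dD HD]; apply: contrapT => nD.
have [C sC CH] := bounded_index_transversal sgH Hbd.
pose off g := [set x | ~ D (g^-1 * x)].
have offF : finI C off.
  move=> s _; apply: contrapT => s0; apply: nD; exists (enum_fset s) => x.
  apply: contrapT => nDx; apply: s0; exists x => g gs Dgx.
  by apply: nDx; exists g.
have [x xoff] :=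
  saturated_filter sat_S (finI_filter offF) (small_setU Kinf sC sA).
have [c Cc Hcx] := CH x; apply: (xoff (off c)); last exact: HD.
  apply: definableC; apply: definable_translate; first by left.
  by apply: definableS dD => a; right.
by exists (off c) => //; exact: finI_from1.
Qed.

Lemma infinitely_commutator_bounded z : infinitely_commutator z -> H z.
Proof.
move=> [Y zY]; apply/(type_definableP S A H).1 => // D dD HD.
have [half [half_nbhd halfV halfM]] := definable_nbhd_halve (conj dD HD).
have [quarter [quarter_nbhd quarterV quarterM]] :=
  definable_nbhd_halve half_nbhd.
have [eighth [eighth_nbhd eighthV eighthM]] :=
  definable_nbhd_halve quarter_nbhd.
have [i [j [ij conjE]]] :=
  left_generic_conj Y (definable_nbhd_left_generic eighth_nbhd).
have conj_half x : half (((Y i)^-1 * Y j) ^ x).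
  have [u [v [w [Eu Ev Ew ->]]]] := conjE x.
  by apply: quarterM; [apply: quarterV|]; exact: eighthM.
have [w ->] := zY i j ij; rewrite commgEl; apply: halfM => //.
by apply: halfV; have := conj_half 1; rewrite conjg1.
Qed.

End BoundedTypeDefinable.

Theorem type_absolutely_connected_criterion (X : groupType) :
  (forall H : set X,
     is_subgroup H -> @infinitely_commutator X `<=` H -> H = setT) ->
  type_absolutely_connected X.
Proof.
move=> gen L S.
have big := for_sufficiently_bigI for_sufficiently_big_infinite
  (for_sufficiently_big_ge (set X)).
apply: for_sufficiently_bigS big => K [Kinf XK] Xs Ss e [emb sat_Ss _].
rewrite eqEsubset; split=> // y _ H [sgH Hdef Hbd].
have sX : small K (range e) by exact: small_powerset_le (card_image_le _ _) XK.
have eH : e @^-1` H = setT.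
  apply: gen => [|z zc]; first exact: preimage_subgroup (embM emb) _ sgH.
  apply: (infinitely_commutator_bounded Kinf sat_Ss sX) => //.
  exact: infinitely_commutator_morph (embM emb) zc.
apply/(type_definableP Ss (range e) H).1 => // D dD HD; apply: contrapT => nDy.
have [|m] := definable_emb_nonempty emb (definableC dD); first by exists y.
by apply; apply: HD; rewrite -[H _]/((e @^-1` H) m) eH.
Qed.

Lemma component00_full (X : groupType) (L : language) (S : expansion L X) :
  type_absolutely_connected X ->
  for_sufficiently_big (fun K =>
    forall (Xs : groupType) (Ss : expansion L Xs) (e : X -> Xs),
      monster_model K S Ss e -> component00 Ss K set0 = setT).
Proof.
move=> /(_ L S); apply: for_sufficiently_bigS => K full Xs Ss e /full.
rewrite !eqEsubset => -[_ full_e]; split=> // x _ H [sgH Hdef Hbd].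
by apply: full_e => //; split=> //; exact: type_definableS Hdef.
Qed.

(** * Invariant subgroups of bounded index *)

Section Automorphism.
Variables (L : language) (G : groupType) (S : expansion L G) (s : G -> G).
Hypothesis auts : automorphism S s.

Lemma automorphismM : {morph s : x y / x * y}.
Proof. by case: auts. Qed.

Lemma invariant_automorphism H x : invariant S set0 H -> H (s x) <-> H x.
Proof.
move=> /(_ s auts)/(_ (fun _ => False_ind _)) sH.
have [/bij_inj sinj _ _ _] := auts.
split=> [|Hx]; last by rewrite -sH; exists x.
by rewrite -{1}sH => -[y Hy /sinj <-].
Qed.

Lemma automorphism_image (H : set G) :
  (forall x, H (s x) <-> H x) -> s @` H = H.
Proof.
have [[t _ ts] _ _ _] := auts; move=> sH.
apply/seteqP; split=> [_ [x /sH Hx <-]//|x Hx].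
by exists (t x); rewrite ?ts //; apply/sH; rewrite ts.
Qed.

End Automorphism.

Lemma conj_core_invariant (L : language) (G : groupType) (S : expansion L G)
    (H : set G) :
  invariant S set0 H -> invariant S set0 (conj_core H).
Proof.
move=> Hinv s auts _; apply: (automorphism_image auts) => x.
have sJ g : H (s x ^ s g) <-> H (x ^ g).
  rewrite -(morphMJ (automorphismM auts)).
  exact: (invariant_automorphism auts _ Hinv).
have [[t _ ts] _ _ _] := auts.
by split=> Hx g; [apply/sJ|rewrite -[g]ts; apply/sJ].
Qed.

Definition same_type2 (L : language) (G : groupType) (S : expansion L G)
    (x y x' y' : G) :=
  forall R, definable2 S set0 R -> R x y <-> R x' y'.

Lemma same_type2_automorphism (L : language) (G : groupType) (S : expansion L G)
    (K : cardinal) (x y x' y' : G) :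
  strongly_homogeneous S K -> infinite_set [set: K] -> same_type2 S x y x' y' ->
  exists s, [/\ automorphism S s, s x = x' & s y = y'].
Proof.
move=> homS Kinf xy; pose A : set G := [set x; y].
pose f (a : A) := if val a == x then x' else y'.
pose r (a : A) : option (option (set0 : set G)) :=
  if val a == x then Some None else None.
have xr a : oapp (oapp val x) y (r a) = val a.
  by rewrite /r; case: eqP => //; case: (set_valP a) => [->|->].
have fr a : oapp (oapp val x') y' (r a) = f a by rewrite /r /f; case: eqP.
have [phi|s auts sf] := homS A (small_finite Kinf (finite_set2 x y)) f.
  have := xy (fun z w => sat S (oapp (oapp val z) w) (frename r phi)).
  rewrite !sat_frename.
  have -> : oapp (oapp val x) y \o r = val by exact/funext.
  have -> : oapp (oapp val x') y' \o r = f by exact/funext.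
  by apply; exists (frename r phi).
have eq_def : definable2 S set0 eq.
  by exists (FEq (TVar L (Some None)) (TVar L None)).
exists s; split=> //.
  by have := sf (SigSub (mem_set (or_introl erefl : A x))); rewrite /f /= eqxx.
have := sf (SigSub (mem_set (or_intror erefl : A y))); rewrite /f /=.
by case: eqP => // yx ->; apply: (xy _ eq_def).1.
Qed.

Section InvariantSubgroups.
Variables (L : language) (X Xs : groupType) (K : cardinal).
Variables (S : expansion L X) (Ss : expansion L Xs) (e : X -> Xs).
Hypotheses (mon : monster_model K S Ss e) (Kinf : infinite_set [set: K]).
Hypothesis sX : small K (range e).

Let emb : elementary_embedding S Ss e. Proof. by case: mon. Qed.
Let sat_Ss : saturated Ss K. Proof. by case: mon. Qed.
Let hom_Ss : strongly_homogeneous Ss K. Proof. by case: mon. Qed.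

Lemma coheir_same_typer (B : set Xs) (U : set_system X) c z w : UltraFilter U ->
  B c -> coheir Ss e B U z -> coheir Ss e B U w -> same_type2 Ss c z c w.
Proof.
move=> UU Bc Uz Uw R Rdef; have Rc := definable_fiberl (@sub0set _ B) Bc Rdef.
by rewrite (coheirP UU Uz Rc) (coheirP UU Uw Rc).
Qed.

(* [R x w] only depends on the set of all [m] such that [R x (e m)], that is, *)
(* on the type of [x] over [e X].                                             *)
Lemma coheir_same_typel (B : set Xs) (U V : set_system X) x y w :
  UltraFilter U -> UltraFilter V -> B x -> B y -> coheir Ss e B V w ->
  coheir Ss e (range e) U x -> coheir Ss e (range e) U y ->
  same_type2 Ss x w y w.
Proof.
move=> UU UV Bx By Vw Ux Uy R Rdef.
rewrite (coheirP UV Vw (definable_fiberl (@sub0set _ B) Bx Rdef)).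
rewrite (coheirP UV Vw (definable_fiberl (@sub0set _ B) By Rdef)).
suff -> : e @^-1` R x = e @^-1` R y by [].
apply/funext => m; apply/propext.
have Rm : definable Ss (range e) (R ^~ (e m)).
  by apply: definable_fiberr Rdef => //; exists m.
by rewrite /preimage /= (coheirP UU Ux Rm) (coheirP UU Uy Rm).
Qed.

Section CoheirCosets.
Variable H : set Xs.
Hypotheses (sgH : is_subgroup H) (Hinv : invariant Ss set0 H).
Hypothesis Hbd : bounded_index K H.

Lemma invariant_same_type2 x y x' y' :
  same_type2 Ss x y x' y' -> H (x^-1 * y) -> H (x'^-1 * y').
Proof.
move=> /(same_type2_automorphism hom_Ss Kinf)[s [auts <- <-]] Hxy.
have sM := automorphismM auts; rewrite -(morphMV sM) -sM.
exact/(invariant_automorphism auts).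
Qed.

(* Realize [U] by [z] over a transversal [C], then by [w] over [C], [t] and   *)
(* [z]. Then [w] is in the coset of [z], having the same type over the        *)
(* representative of that coset, and [t] is in the coset of [w], since [t, w] *)
(* has the same type as [z, w].                                               *)
Lemma coheir_coset U x y : UltraFilter U ->
  coheir Ss e (range e) U x -> coheir Ss e (range e) U y -> H (x^-1 * y).
Proof.
move=> UU; have [C sC CH] := bounded_index_transversal sgH Hbd.
pose B := C `|` range e; have sB : small K B by exact: small_setU.
have UeU : ProperFilter (e @ U) by exact: fmap_proper_filter.
have [z Uz] := saturated_filter sat_Ss UeU sB.
have Uz_e : coheir Ss e (range e) U z by apply: realizes_overS Uz => a; right.
suff near_z t : coheir Ss e (range e) U t -> H (t^-1 * z).
  by move=> /near_z xz /near_z/(coset_sym sgH); exact: coset_trans xz.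
move=> Ut; have [c Cc cz] := CH z.
have [|w Uw] := saturated_filter (A := B `|` [set t; z]) sat_Ss UeU.
  exact/small_setU/small_finite/finite_set2.
have cw : H (c^-1 * w).
  apply: invariant_same_type2 cz; apply: (coheir_same_typer (B := B)) => //.
    by left.
  by apply: realizes_overS Uw => a; left.
have zw : H (z^-1 * w) by apply: (coset_trans sgH) cw; exact: coset_sym.
apply: (coset_trans sgH (y := w)); last exact: coset_sym.
apply: invariant_same_type2 zw.
by apply: (coheir_same_typel UU UU _ _ Uw) => //; right; [right|left].
Qed.

Lemma conj_core_card :
  range (left_coset (conj_core H)) #<= [set: set (set (set X) * set (set X))].
Proof.
pose ultra_of g U := UltraFilter U /\ coheir Ss e (range e) U g.
pose action x := [set UV | exists g, ultra_of g UV.1 /\ ultra_of (x * g) UV.2].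
apply: (card_left_cosets_le (conj_core_subgroup sgH) (f := action)) => x y xy g.
have [U UU Ug] := coheir_exists emb g.
have [V UV Vxg] := coheir_exists emb (x * g).
have : action x (U, V) by exists g.
rewrite xy => -[g' [/= [_ Ug'] [_ Vyg']]].
have gg' : H (g'^-1 * g) by exact: coheir_coset Ug' Ug.
have xyg : H ((x * g)^-1 * (y * g')) by exact: coheir_coset Vxg Vyg'.
have -> : (x^-1 * y) ^ g = (x * g)^-1 * (y * g') * (g'^-1 * g).
  by rewrite conjgE invgM !mulgA mulgK.
by case: sgH => _ HM _; exact: HM.
Qed.

End CoheirCosets.

End InvariantSubgroups.

Lemma component_infty_subgroup (L : language) (G : groupType)
    (S : expansion L G) (K : cardinal) (A : set G) :
  is_subgroup (component_infty S K A).
Proof.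
split=> [H [[]]//|x y xH yH H HP|x xH H HP]; case: (HP) => -[_ HM HV] _ _.
  by apply: HM; [exact: xH|exact: yH].
by apply: HV; exact: xH.
Qed.

Lemma component_infty_normal (X : groupType) (L : language)
    (S : expansion L X) :
  for_sufficiently_big (fun K =>
    forall (Xs : groupType) (Ss : expansion L Xs) (e : X -> Xs),
      monster_model K S Ss e -> is_normal_in (component_infty Ss K set0) setT).
Proof.
have big := for_sufficiently_bigI for_sufficiently_big_infinite
  (for_sufficiently_bigI (for_sufficiently_big_ge (set X))
    (for_sufficiently_big_ge (set (set (set (set X) * set (set X)))))).
apply: for_sufficiently_bigS big => K [Kinf [XK UVK]] Xs Ss e mon.
split=> //; first exact: component_infty_subgroup.
move=> g x _ xN H [sgH Hinv Hbd]; apply: (xN (conj_core H)); split.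
- exact: conj_core_subgroup.
- exact: conj_core_invariant.
- apply: small_powerset_le UVK; apply: (conj_core_card mon Kinf) => //.
  exact: small_powerset_le (card_image_le _ _) XK.
Qed.

Lemma component_infty_ker (L : language) (G : groupType) (S : expansion L G)
    (K : cardinal) (Q : groupType) (f : G -> Q) :
  {morph f : x y / x * y} -> (forall s x, automorphism S s -> f (s x) = f x) ->
  small K [set: Q] -> forall x, component_infty S K set0 x -> f x = 1.
Proof.
move=> fM fS sQ x x_infty; have kerG : is_subgroup (f @^-1` [set 1]).
  apply: (preimage_subgroup fM).
  by split=> [|_ _ -> ->|_ ->]; rewrite ?mulg1 ?invg1.
apply: (x_infty (f @^-1` [set 1])); split=> //.
  move=> s auts _; apply: (automorphism_image auts) => y.
  by rewrite /preimage /= fS.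
apply: small_le sQ; apply: (card_left_cosets_le kerG (f := f)) => y z.
exact: (morphM_eq fM y z).1.
Qed.

(** * Free products of copies of a group *)

Section FreePower.
Variables (I : choiceType) (A : groupType).

Implicit Types (i : I) (a b : A) (l : I * A) (u v w : seq (I * A)).

Definition reduced w :=
  (1 \notin unzip2 w) && sorted [rel i j | i != j] (unzip1 w).

Definition begins_in i w := if w is l :: _ then i == l.1 else false.

Definition lcons l w := if l.2 == 1 then w else l :: w.

Definition lmul l w :=
  if w is l' :: w' then
    if l.1 == l'.1 then lcons (l.1, l.2 * l'.2) w' else lcons l w
  else lcons l w.

Definition wmul w w' := foldr lmul w' w.

Definition linv l := (l.1, l.2^-1).

Definition winv w := rev (map linv w).

Lemma reduced_cons l w :
  reduced (l :: w) = [&& l.2 != 1, ~~ begins_in l.1 w & reduced w].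
Proof.
rewrite /reduced /= inE negb_or eq_sym -andbA; congr (_ && _).
by case: w => [|l' w] //=; rewrite andbCA.
Qed.

Lemma reduced_cat_cons u l w :
  reduced (u ++ l :: w) = reduced (rcons u l) && reduced (l :: w).
Proof.
rewrite /reduced /unzip1 /unzip2 !map_cat !map_rcons /= mem_cat mem_rcons !inE.
rewrite sorted_cat_cons; case: (1 \in map snd u); case: (1 \in map snd w);
  by case: (1 == l.2) => //=; rewrite ?orbT //= !andbF.
Qed.

Lemma reduced_rev w : reduced (rev w) = reduced w.
Proof.
rewrite /reduced /unzip1 /unzip2 !map_rev mem_rev rev_sorted; congr (_ && _).
by apply: eq_sorted => i j; rewrite /= eq_sym.
Qed.

Lemma reduced_rcons_letter w i a b : b != 1 ->
  reduced (rcons w (i, a)) -> reduced (rcons w (i, b)).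
Proof.
move=> b1; rewrite -![reduced (rcons _ _)]reduced_rev !rev_rcons.
by rewrite !reduced_cons /=; case/and3P=> _ -> ->; rewrite b1.
Qed.

Lemma reduced_lcons i a w :
  reduced w -> ~~ begins_in i w -> reduced (lcons (i, a) w).
Proof.
move=> rw iw; rewrite /lcons /=; case: eqP => // /eqP a1.
by rewrite reduced_cons a1 iw.
Qed.

Lemma reduced_lcons_split i w : reduced w ->
  exists b v, [/\ w = lcons (i, b) v, reduced v & ~~ begins_in i v].
Proof.
have trivial_split v : reduced v -> ~~ begins_in i v ->
    exists b v', [/\ v = lcons (i, b) v', reduced v' & ~~ begins_in i v'].
  by exists 1, v; rewrite /lcons eqxx.
case: w => [|[j b] w] rw; first exact: trivial_split.
have [ij|ij] := eqVneq i j; last exact: trivial_split.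
move: rw; rewrite reduced_cons => /and3P[b1 jw rw].
by exists b, w; rewrite /lcons /= (negPf b1) ij.
Qed.

Lemma lmul_lcons i a b v : ~~ begins_in i v ->
  lmul (i, a) (lcons (i, b) v) = lcons (i, a * b) v.
Proof.
move=> iv; rewrite {1}/lcons.
case: eqP => [/= ->|_]; last by rewrite /lmul eqxx.
by rewrite mulg1; case: v iv => [|l v] //= /negPf->.
Qed.

Lemma lmul_reduced l w : reduced (l :: w) -> lmul l w = l :: w.
Proof.
case: l => i a; rewrite reduced_cons => /and3P[/= a1 iw _].
by have := lmul_lcons a 1 iw; rewrite mulg1 /lcons eqxx (negPf a1).
Qed.

Lemma lmul1 i w : reduced w -> lmul (i, 1) w = w.
Proof.
by move=> /(reduced_lcons_split i)[b [v [-> _ iv]]]; rewrite lmul_lcons ?mul1g.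
Qed.

Lemma lmulM i a b w :
  reduced w -> lmul (i, a) (lmul (i, b) w) = lmul (i, a * b) w.
Proof.
by move=> /(reduced_lcons_split i)[c [v [-> _ iv]]]; rewrite !lmul_lcons ?mulgA.
Qed.

Lemma reduced_lmul l w : reduced w -> reduced (lmul l w).
Proof.
case: l => i a /(reduced_lcons_split i)[b [v [-> rv iv]]].
by rewrite lmul_lcons //; exact: reduced_lcons.
Qed.

Lemma reduced_wmul w w' : reduced w' -> reduced (wmul w w').
Proof. by move=> rw'; elim: w => //= l w; exact: reduced_lmul. Qed.

Lemma wmul_lmul l w w' : reduced w -> reduced w' ->
  wmul (lmul l w) w' = lmul l (wmul w w').
Proof.
case: l => i a /(reduced_lcons_split i)[b [v [-> rv iv]]] rw'.
have rvw' : reduced (wmul v w') by exact: reduced_wmul.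
have wmul_lcons c : wmul (lcons (i, c) v) w' = lmul (i, c) (wmul v w').
  by rewrite /lcons; case: eqP => [/= ->|//]; rewrite lmul1.
by rewrite lmul_lcons // !wmul_lcons lmulM.
Qed.

Lemma wmulA u v w : reduced v -> reduced w ->
  wmul u (wmul v w) = wmul (wmul u v) w.
Proof.
move=> rv rw; elim: u => //= l u ->.
by rewrite wmul_lmul //; exact: reduced_wmul.
Qed.

Lemma wmul_cat w w' : reduced (w ++ w') -> wmul w w' = w ++ w'.
Proof.
elim: w => //= l w IH; rewrite -cat_cons => rlw; rewrite IH ?lmul_reduced //.
by move: rlw; rewrite reduced_cons => /and3P[].
Qed.

Lemma wmul_nil w : reduced w -> wmul w [::] = w.
Proof. by move=> rw; rewrite wmul_cat cats0. Qed.

Lemma reduced_winv w : reduced w -> reduced (winv w).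
Proof.
rewrite /winv reduced_rev /reduced /unzip1 /unzip2 -!map_comp => /andP[w1 ws].
apply/andP; split=> //; apply: contra w1 => /mapP[l lw /eqP].
by rewrite eq_sym invg_eq1 => /eqP l1; apply/mapP; exists l.
Qed.

Lemma winvK : involutive winv.
Proof.
move=> w; rewrite /winv map_rev revK -map_comp map_id_in // => -[i a] _.
by rewrite /linv /= invgK.
Qed.

Lemma wmulV w : reduced w -> wmul (winv w) w = [::].
Proof.
elim: w => //= -[i a] w IH; rewrite reduced_cons => /and3P[_ _ rw].
rewrite /winv /= rev_cons /wmul foldr_rcons /= /lmul eqxx mulVg /lcons eqxx.
exact: IH.
Qed.

Definition free_power := {w : seq (I * A) | reduced w}.

HB.instance Definition _ := Choice.on free_power.

Definition free_power_of w (rw : reduced w) : free_power := exist _ w rw.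

Definition free_power_mul (x y : free_power) : free_power :=
  free_power_of (reduced_wmul (val x) (valP y)).

Definition free_power_inv (x : free_power) : free_power :=
  free_power_of (reduced_winv (valP x)).

Definition free_power_one : free_power := free_power_of (isT : reduced [::]).

Let free_power_mulA : associative free_power_mul.
Proof. by move=> x y z; apply: val_inj; apply: wmulA; exact: valP. Qed.

Let free_power_mul1 : left_id free_power_one free_power_mul.
Proof. by move=> x; exact: val_inj. Qed.

Let free_power_mulr1 : right_id free_power_one free_power_mul.
Proof. by move=> x; apply: val_inj; apply: wmul_nil; exact: valP. Qed.

Let free_power_mulV : left_inverse free_power_one free_power_inv free_power_mul.
Proof. by move=> x; apply: val_inj; apply: wmulV; exact: valP. Qed.

Let free_power_mulrV :
  right_inverse free_power_one free_power_inv free_power_mul.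
Proof.
move=> x; apply: val_inj; rewrite /= -{1}[val x]winvK; apply: wmulV.
exact: reduced_winv (valP x).
Qed.

HB.instance Definition _ := isGroup.Build free_power free_power_mulA
  free_power_mul1 free_power_mulr1 free_power_mulV free_power_mulrV.

Lemma reduced_letter i a : reduced (lcons (i, a) [::]).
Proof. exact: reduced_lcons. Qed.

Definition letter i a : free_power := free_power_of (reduced_letter i a).

Lemma letterM i : {morph letter i : a b / a * b}.
Proof.
move=> a b; apply: val_inj => /=; rewrite -(lmul_lcons a b) //.
by rewrite {2}/lcons; case: eqP => [/= ->|//]; rewrite lmul1 ?reduced_letter.
Qed.

Lemma free_power_generated (H : set free_power) : is_subgroup H ->
  (forall i a, H (letter i a)) -> H = setT.
Proof.
move=> [H1 HM _] HL; rewrite eqEsubset; split=> // -[w rw] _.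
rewrite -[exist _ w rw]/(free_power_of rw); elim: w rw => [|[i a] w IH] rw.
  by have -> : free_power_of rw = 1 by exact: val_inj.
have := rw; rewrite reduced_cons => /and3P[/= a1 _ rw'].
have -> : free_power_of rw = letter i a * free_power_of rw'.
  by apply: val_inj; rewrite /= {1}/lcons (negPf a1) /= lmul_reduced.
by apply: HM; [exact: HL|exact: IH].
Qed.

(* In a product of reduced words, letters cancel in inverse pairs until at  *)
(* most one pair of letters, in the factor of index [i], is merged.         *)
Lemma prod_wmul (i0 : I) w w' : reduced w -> reduced w' ->
  exists i, forall (H : groupType) (f : I -> A -> H),
    (forall j a, f j a^-1 = (f j a)^-1) -> {morph f i : a b / a * b} ->
    \prod_(l <- wmul w w') f l.1 l.2 =
    (\prod_(l <- w) f l.1 l.2) * (\prod_(l <- w') f l.1 l.2).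
Proof.
elim/last_ind: w w' => [|w [i a] IH] w' rwa rw'.
  by exists i0 => H f *; rewrite big_nil mul1g.
have [rw a1] : reduced w /\ a != 1.
  move: rwa; rewrite -reduced_rev rev_rcons reduced_cons reduced_rev.
  by case/and3P.
case: w' rw' => [|[j b] w'] rbw'.
  by exists i0 => H f *; rewrite wmul_nil // big_nil mulg1.
have := rbw'; rewrite reduced_cons => /and3P[/= _ jw' rw'].
have [ij|ij] := eqVneq i j; last first.
  exists i0 => H f _ _; rewrite wmul_cat ?big_cat // cat_rcons.
  by rewrite reduced_cat_cons rwa reduced_cons a1 /= ij.
rewrite -{j}ij in rbw' jw' *.
rewrite [wmul _ _]foldr_rcons -/(wmul _ _) /lmul eqxx /lcons /=.
have [ab1|ab1] := eqVneq (a * b) 1.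
  have [k kP] := IH w' rw rw'; exists k => H f fV fk.
  rewrite kP // big_rcons big_cons /=.
  have -> : b = a^-1 by apply: (@mulgI _ a); rewrite ab1 mulgV.
  by rewrite fV !mulgA mulgK.
exists i => H f fV fi; rewrite wmul_cat.
  by rewrite big_cat big_cons big_rcons big_cons /= fi !mulgA.
rewrite reduced_cat_cons (reduced_rcons_letter _ rwa) //.
by rewrite reduced_cons ab1 jw'.
Qed.

End FreePower.

(** * The special linear group *)

Section SpecialLinear.
Variables (n : nat) (R : comNzRingType).
Local Open Scope ring_scope.

Definition special_linear := {M : 'M[R]_n | \det M == 1}.

HB.instance Definition _ := Choice.on special_linear.

Let det_mul_eq1 (x y : special_linear) : \det (val x *m val y) == 1.
Proof. by rewrite det_mulmx (eqP (valP x)) (eqP (valP y)) mulr1. Qed.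

Let det_adj_eq1 (x : special_linear) : \det (\adj (val x)) == 1.
Proof.
have := det_mulmx (val x) (\adj (val x)).
by rewrite mul_mx_adj (eqP (valP x)) det1 mul1r => <-.
Qed.

Let det_one_eq1 : \det (1%:M : 'M[R]_n) == 1.
Proof. by rewrite det1. Qed.

Definition special_linear_mul (x y : special_linear) : special_linear :=
  exist _ (val x *m val y) (det_mul_eq1 x y).
Definition special_linear_inv (x : special_linear) : special_linear :=
  exist _ (\adj (val x)) (det_adj_eq1 x).
Definition special_linear_one : special_linear := exist _ 1%:M det_one_eq1.

Let special_linear_mulA : associative special_linear_mul.
Proof. by move=> x y z; apply: val_inj; exact: mulmxA. Qed.

Let special_linear_mul1 : left_id special_linear_one special_linear_mul.
Proof. by move=> x; apply: val_inj; exact: mul1mx. Qed.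

Let special_linear_mulr1 : right_id special_linear_one special_linear_mul.
Proof. by move=> x; apply: val_inj; exact: mulmx1. Qed.

Let special_linear_mulV :
  left_inverse special_linear_one special_linear_inv special_linear_mul.
Proof. by move=> x; apply: val_inj; rewrite /= mul_adj_mx (eqP (valP x)). Qed.

Let special_linear_mulrV :
  right_inverse special_linear_one special_linear_inv special_linear_mul.
Proof. by move=> x; apply: val_inj; rewrite /= mul_mx_adj (eqP (valP x)). Qed.

HB.instance Definition _ := isGroup.Build special_linear
  special_linear_mulA special_linear_mul1 special_linear_mulr1
  special_linear_mulV special_linear_mulrV.

Lemma val_special_linearM (x y : special_linear) :
  val (x * y)%g = val x *m val y.
Proof. by []. Qed.

End SpecialLinear.

Section Matrix22.
Variable R : comNzRingType.
Local Open Scope ring_scope.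

Definition mx22 (a b c d : R) : 'M[R]_2 :=
  \matrix_(i, j) if i == 0 then if j == 0 then a else b
                 else if j == 0 then c else d.

Lemma mx22E (M : 'M[R]_2) : M = mx22 (M 0 0) (M 0 1) (M 1 0) (M 1 1).
Proof.
by apply/matrixP => -[[|[|//]] i2] -[[|[|//]] j2]; rewrite mxE /=;
  congr (M _ _); apply: val_inj.
Qed.

Lemma mulmx22 a b c d a' b' c' d' : mx22 a b c d *m mx22 a' b' c' d' =
  mx22 (a * a' + b * c') (a * b' + b * d') (c * a' + d * c') (c * b' + d * d').
Proof.
apply/matrixP => i j; rewrite !mxE !big_ord_recl big_ord0 addr0 !mxE /=.
by case: (i == 0); case: (j == 0).
Qed.

Lemma det_mx22 a b c d : \det (mx22 a b c d) = a * d - b * c.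
Proof.
rewrite (expand_det_row _ 0) !big_ord_recl big_ord0 /cofactor !det_mx11 !mxE /=.
by rewrite expr0 expr1; ring.
Qed.

End Matrix22.

Section SL2.
Variable F : fieldType.
Local Open Scope ring_scope.

Local Notation SL2 := (special_linear 2 F).

Definition upper (b : F) : SL2 := insubd (1%g : SL2) (mx22 1 b 0 1).
Definition lower (c : F) : SL2 := insubd (1%g : SL2) (mx22 1 0 c 1).
(* [diag 0] is the junk value [1]. *)
Definition diag (r : F) : SL2 := insubd (1%g : SL2) (mx22 r 0 0 r^-1).

Lemma val_upper b : val (upper b) = mx22 1 b 0 1.
Proof. by rewrite insubdK // -topredE /= det_mx22 mulr1 mulr0 subr0. Qed.

Lemma val_lower c : val (lower c) = mx22 1 0 c 1.
Proof. by rewrite insubdK // -topredE /= det_mx22 mulr1 mul0r subr0. Qed.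

Lemma val_diag r : r != 0 -> val (diag r) = mx22 r 0 0 r^-1.
Proof.
by move=> r0; rewrite insubdK // -topredE /= det_mx22 divff // mul0r subr0.
Qed.

Lemma sl2_generated (H : set SL2) : is_subgroup H ->
  (forall b, H (upper b)) -> (forall c, H (lower c)) -> H = setT.
Proof.
move=> [H1 HM HV] HU HL; rewrite eqEsubset; split=> // x _.
have gen (y : SL2) : val y 1 0 != 0 -> H y.
  move: (mx22E (val y)) (eqP (valP y)).
  move: (val y 0 0) (val y 0 1) (val y 1 0) (val y 1 1) => a b c d yE.
  rewrite yE det_mx22 => det1 c0.
  have -> : y = (upper ((a - 1) / c) * lower c * upper ((d - 1) / c))%g.
    apply: val_inj.
    rewrite !val_special_linearM !val_upper val_lower yE !mulmx22.
    have -> : b = (a * d - 1) / c by rewrite -det1; field.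
    by congr mx22; field.
  by apply: (HM); first apply: HM.
have [x0|] := eqVneq (val x 1 0) 0; last exact: gen.
rewrite -[x](mulKg (lower 1)); apply: HM; first exact: HV.
apply: gen; move: x0 (mx22E (val x)) (eqP (valP x)).
rewrite val_special_linearM.
move: (val x 0 0) (val x 0 1) (val x 1 0) (val x 1 1) => a b c d c0 ->.
rewrite det_mx22 c0 val_lower mulmx22 mxE /= !mulr0 subr0 !mul1r addr0.
by apply: contra_eq_neq => ->; rewrite mul0r eq_sym oner_eq0.
Qed.

Lemma diag_div r s : r != 0 -> s != 0 ->
  ((diag r)^-1 * diag s)%g = diag (s / r).
Proof.
move=> r0 s0; apply: (mulgI (diag r)); rewrite mulVKg; apply: val_inj.
rewrite val_special_linearM !val_diag ?mulf_neq0 ?invr_neq0 // mulmx22.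
by congr mx22; field; rewrite r0 ?s0.
Qed.

Lemma upper_neqV b : b + b != 0 -> upper b != (upper b)^-1%g.
Proof.
apply: contra_neq => bV.
have : val (upper b * upper b)%g = 1%:M by rewrite {2}bV mulgV.
rewrite val_special_linearM val_upper mulmx22 => /matrixP/(_ 0 1).
by rewrite !mxE /= mul1r mulr1.
Qed.

Lemma upper_commutator b r : r != 0 -> r ^+ 2 != 1 ->
  upper b = [~ diag r, upper (r ^+ 2 * b / (r ^+ 2 - 1))]%g.
Proof.
move=> r0; rewrite -subr_eq0 => r2; apply: commg_eq; apply: val_inj.
rewrite !val_special_linearM !val_upper val_diag // !mulmx22.
by congr mx22; field; rewrite ?r0 ?r2.
Qed.

Lemma lower_commutator c r : r != 0 -> r ^+ 2 != 1 ->
  lower c = [~ diag r, lower (c / (1 - r ^+ 2))]%g.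
Proof.
move=> r0; rewrite eq_sym -subr_eq0 => r2; apply: commg_eq; apply: val_inj.
rewrite !val_special_linearM !val_lower val_diag // !mulmx22.
by congr mx22; field; rewrite ?r0 ?r2.
Qed.

Section InfiniteOrder.
Variable q : F.
Hypothesis q_inj : injective (fun n => q ^+ n).

Let exp_q_neq0 n : q ^+ n != 0.
Proof.
rewrite expf_neq0 //; apply/eqP => q0.
by have /= := @q_inj 1%N 2%N; rewrite q0 !expr0n => /(_ erefl).
Qed.

Let powers_ratio i j : i != j ->
  [/\ q ^+ j / q ^+ i != 0, (q ^+ j / q ^+ i) ^+ 2 != 1 &
      ((diag (q ^+ i))^-1 * diag (q ^+ j))%g = diag (q ^+ j / q ^+ i)].
Proof.
move=> ij; split; last by apply: diag_div; exact: exp_q_neq0.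
  by rewrite mulf_neq0 ?invr_neq0 ?exp_q_neq0.
rewrite expr_div_n -!exprM; apply: contra ij => /eqP/divr1_eq/q_inj/eqP.
by rewrite eqn_mul2r /= eq_sym.
Qed.

Lemma upper_infinitely_commutator b : infinitely_commutator (upper b).
Proof.
exists (fun n => diag (q ^+ n)) => i j /powers_ratio[r0 r2 ->].
by eexists; exact: upper_commutator.
Qed.

Lemma lower_infinitely_commutator c : infinitely_commutator (lower c).
Proof.
exists (fun n => diag (q ^+ n)) => i j /powers_ratio[r0 r2 ->].
by eexists; exact: lower_commutator.
Qed.

Theorem free_power_sl2_type_absolutely_connected (I : choiceType) :
  type_absolutely_connected (free_power I SL2).
Proof.
apply: type_absolutely_connected_criterion => H sgH cH.
apply: free_power_generated => // i a.
suff iH : letter i @^-1` H = setT.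
  by rewrite -[H _]/((letter i @^-1` H) a) iH.
have iM := @letterM _ SL2 i.
apply: sl2_generated => [|b|c]; first exact: preimage_subgroup iM _ sgH.
  exact/cH/(infinitely_commutator_morph iM)/upper_infinitely_commutator.
exact/cH/(infinitely_commutator_morph iM)/lower_infinitely_commutator.
Qed.

End InfiniteOrder.

End SL2.

(** * Standard parts *)

Definition preimage_language (I : Type) (G : I -> Type) : language :=
  @Language void (fun=> 0%N) {i & set (G i)} (fun=> 1%N).

Definition preimage_expansion (I : Type) (G : I -> Type) (X : groupType)
    (f : forall i, X -> G i) : expansion (preimage_language G) X :=
  @Expansion (preimage_language G) X (fun _ _ => 1)
    (fun r xs => tagged r (f (tag r) (xs ord0))).

Section StandardPart.
Variables (I : choiceType) (G : I -> topologicalGroupType).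
Hypothesis G_compact : forall i, compact [set: G i].
Hypothesis G_hausdorff : forall i, hausdorff_space (G i).
Variables (X : groupType) (f : forall i, X -> G i).
Hypothesis f_almost_morph : forall x y i j, i != j ->
  f i (x * y) = f i x * f i y \/ f j (x * y) = f j x * f j y.
Hypothesis f_interpolation : forall (g : forall i, G i) (s : seq I),
  exists x, forall i, i \in s -> f i x = g i.

Local Notation L := (preimage_language G).
Local Notation S := (preimage_expansion f).

Section Monster.
Variables (K : cardinal) (Xs : groupType) (Ss : expansion L Xs) (e : X -> Xs).
Hypothesis mon : monster_model K S Ss e.

Let emb : elementary_embedding S Ss e. Proof. by case: mon. Qed.

Definition star i (C : set (G i)) : set Xs :=
  [set x | @rel_interp L Xs Ss (existT _ i C) (fun=> x)].

Lemma definable_star (A : set Xs) i (C : set (G i)) : definable Ss A (star C).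
Proof. by exists (@FRel L _ (existT _ i C) (fun=> TVar L None)). Qed.

Lemma star_emb i (C : set (G i)) m : star C (e m) <-> C (f i m).
Proof.
by apply: iff_sym; exact: (emb (@FRel L _ (existT _ i C) (fun=> TVar L m))).
Qed.

Lemma preimage_star i (C : set (G i)) : e @^-1` star C = f i @^-1` C.
Proof. by apply/funext => m; apply/propext; exact: star_emb. Qed.

Lemma coheir_star (U : set_system X) x i (C : set (G i)) : UltraFilter U ->
  coheir Ss e (range e) U x -> star C x <-> (f i @ U) C.
Proof.
by move=> UU Ux; rewrite (coheirP UU Ux (definable_star _ C)) preimage_star.
Qed.

Lemma standard_part_exists i x : exists g : G i, forall C, nbhs g C -> star C x.
Proof.
have [U UU Ux] := coheir_exists emb x; have fU := fmap_ultra (f i) UU.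
have := @G_compact i; rewrite compact_ultra => /(_ _ fU filterT)[g [_ Ug]].
by exists g => C /Ug UC; apply/(coheir_star _ UU Ux).
Qed.

Definition standard_part (x : Xs) : product_group G :=
  fun i => sval (cid (standard_part_exists i x)).

Lemma standard_partP x i C : nbhs (standard_part x i) C -> star C x.
Proof. exact: (svalP (cid (standard_part_exists i x))). Qed.

Lemma standard_part_unique x i (g : G i) :
  (forall C, nbhs g C -> star C x) -> standard_part x i = g.
Proof.
move=> gx; have [U UU Ux] := coheir_exists emb x.
have fU : ProperFilter (f i @ U) by exact: fmap_proper_filter.
apply: (@cvg_unique _ (@G_hausdorff i) (f i @ U) fU) => C.
  by move=> /standard_partP Cx; exact/(coheir_star C UU Ux).
by move=> /gx Cx; exact/(coheir_star C UU Ux).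
Qed.

Lemma standard_part_mul x y i (W : set_system (X * X)) : ProperFilter W ->
  coheir2 Ss e W x y ->
  W [set p | f i (p.1 * p.2) = f i p.1 * f i p.2] ->
  standard_part (x * y) i = standard_part x i * standard_part y i.
Proof.
move=> WF Wxy WM.
have xW : f i p.1 @[p --> W] --> standard_part x i.
  move=> C /standard_partP /(Wxy _ (definable2_fst (definable_star _ C))).2.
  by apply: (@filterS _ W) => p /star_emb.
have yW : f i p.2 @[p --> W] --> standard_part y i.
  move=> C /standard_partP /(Wxy _ (definable2_snd (definable_star _ C))).2.
  by apply: (@filterS _ W) => p /star_emb.
have xyW : f i (p.1 * p.2) @[p --> W] --> standard_part (x * y) i.
  move=> C /standard_partP /(Wxy _ (definable2_mul (definable_star _ C))).2.
  by apply: (@filterS _ W) => p /=; rewrite -(embM emb) => /star_emb.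
apply: (@cvg_unique _ (@G_hausdorff i) _ _ _ _ xyW).
have xyM : f i p.1 * f i p.2 @[p --> W] -->
    standard_part x i * standard_part y i.
  exact: (cvg_comp2 xW yW (mulg_continuous (_, _))).
apply: cvg_trans xyM; apply: near_eq_cvg.
by apply: filterS WM => p /= ->.
Qed.

Lemma standard_part_almost_morph x y i j : i != j ->
  standard_part (x * y) i = standard_part x i * standard_part y i \/
  standard_part (x * y) j = standard_part x j * standard_part y j.
Proof.
move=> ij; have [W WU Wxy] := coheir2_exists emb x y.
have [Wi|Wi] :=
    in_ultra_setVsetC [set p | f i (p.1 * p.2) = f i p.1 * f i p.2] WU.
  by left; exact: standard_part_mul Wxy Wi.
right; apply: standard_part_mul Wxy _; apply: filterS Wi => p /=.
by case: (f_almost_morph p.1 p.2 ij).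
Qed.

Lemma standard_part_surj (g : product_group G) : infinite_set [set: K] ->
  exists x, standard_part x = g.
Proof.
move=> Kinf; have [_ sat_Ss _] := mon.
pose agree (s : seq I) := [set x | forall i, i \in s -> f i x = g i].
have agreeF : ProperFilter (filter_from setT agree).
  apply: filter_from_proper => [|s _]; last exact: f_interpolation.
  apply: filter_fromT_filter => [|s t]; first by exists [::].
  exists (s ++ t) => x xst.
  by split=> i si; apply: xst; rewrite mem_cat si ?orbT.
have [x xg] := saturated_filter sat_Ss (fmap_proper_filter e agreeF)
  (small_finite Kinf (finite_set0 _)).
exists x; apply: functional_extensionality_dep => i.
apply: standard_part_unique => C gC; apply: (xg _ (definable_star _ C)).
rewrite fmapE preimage_star; exists [:: i] => // m /(_ i (mem_head _ _)) fm.
by rewrite /preimage /= fm; exact: nbhs_singleton.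
Qed.

Definition standard_class (x : Xs) : product_mod_sum G :=
  product_class (standard_part x).

Lemma standard_classM : {morph standard_class : x y / x * y}.
Proof.
move=> x y; rewrite -product_classM; apply/product_class_eq.
set bad := [set i | _]; have [->|/set0P[j bad_j]] := eqVneq bad set0.
  exact: finite_set0.
apply: (@sub_finite_set _ _ [set j]); last exact: finite_set1.
by move=> i bad_i; apply: contrapT => /eqP/(standard_part_almost_morph x y)[].
Qed.

Lemma standard_class_automorphism s x :
  automorphism Ss s -> standard_class (s x) = standard_class x.
Proof.
move=> [_ _ _ srel]; congr product_class.
apply: functional_extensionality_dep => i.
apply: standard_part_unique => C /standard_partP Cx.
exact/(srel (existT _ i C) (fun=> x)).
Qed.

End Monster.

Theorem product_mod_sum_homomorphic_image :
  for_sufficiently_big (fun K =>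
    forall (Xs : groupType) (Ss : expansion L Xs) (e : X -> Xs),
      monster_model K S Ss e -> component00 Ss K set0 = setT ->
      forall nXs : is_normal_in (component_infty Ss K set0)
                                (component00 Ss K set0),
        homomorphic_image_of (product_mod_sum G) (quotient_group nXs)).
Proof.
have big := for_sufficiently_bigI for_sufficiently_big_infinite
  (for_sufficiently_big_ge (set (product_mod_sum G))).
apply: for_sufficiently_bigS big => K [Kinf GK] Xs Ss e mon full nXs.
have clsM := standard_classM mon.
apply: (homomorphic_image_quotient nXs clsM) => [x|].
  apply: (component_infty_ker clsM); last exact: small_powerset_le GK.
  by move=> s y; exact: standard_class_automorphism.
rewrite full eqEsubset; split=> // c _; have [g <-] := product_class_surj c.
have [x xg] := standard_part_surj mon g Kinf; exists x => //.
by rewrite /standard_class xg.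
Qed.

End StandardPart.

(** * Word maps *)

Section WordMaps.
Variables (I : choiceType) (G : I -> groupType) (A : groupType) (a0 : A).
Hypothesis a0_neqV : a0 != a0^-1.

Local Notation J := {i : I & G i}.

Definition letter_map i (j : J) (a : A) : G i :=
  untag 1 (fun g : G i =>
    if a == a0 then g else if a == a0^-1 then g^-1 else 1) j.

Lemma letter_mapV i j a : letter_map i j a^-1 = (letter_map i j a)^-1.
Proof.
rewrite /letter_map /untag; case: eqP => [p|_]; last by rewrite invg1.
have -> : (a^-1 == a0) = (a == a0^-1) by rewrite -(inj_eq invg_inj) invgK.
rewrite (inj_eq invg_inj); have [->|_] := eqVneq a a0.
  by rewrite (negPf a0_neqV).
by case: ifP => _; rewrite ?invgK ?invg1.
Qed.

Lemma letter_map_Tagged i (g : G i) : letter_map i (Tagged G g) a0 = g.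
Proof.
by rewrite /letter_map (untagE _ _ (erefl : tag (Tagged G g) = i)) eqxx.
Qed.

Definition word_map i (x : free_power J A) : G i :=
  \prod_(l <- val x) letter_map i l.1 l.2.

Lemma word_map_almost_morph x y i j : i != j ->
  word_map i (x * y) = word_map i x * word_map i y \/
  word_map j (x * y) = word_map j x * word_map j y.
Proof.
move=> ij; have [k kP] := prod_wmul (Tagged G (1 : G i)) (valP x) (valP y).
have morph_neq n :
    tag k != n -> word_map n (x * y) = word_map n x * word_map n y.
  move=> kn; apply: kP => [j' a|a b]; first exact: letter_mapV.
  by rewrite /letter_map !untag_dflt ?mulg1.
have [ki|] := eqVneq (tag k) i; last by left; exact: morph_neq.
by right; apply: morph_neq; rewrite ki.
Qed.

Lemma word_map_interpolation (g : forall i, G i) (s : seq I) :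
  exists x, forall i, i \in s -> word_map i x = g i.
Proof.
pose w := [seq (Tagged G (g i), a0) | i <- undup s].
have rw : reduced w.
  rewrite /reduced /unzip1 /unzip2 -!map_comp; apply/andP; split.
    by apply/mapP => -[i _ /= a01]; move: a0_neqV; rewrite -a01 invg1 eqxx.
  apply: pairwise_sorted; rewrite -uniq_pairwise map_inj_uniq ?undup_uniq //.
  by move=> i j /(congr1 tag).
exists (free_power_of rw) => i; rewrite -mem_undup /word_map big_map /= => si.
case/splitPr: si (undup_uniq s) => u v.
rewrite cat_uniq /= negb_or => /and3P[_ /andP[iu _] /andP[iv _]].
rewrite big_cat big_cons /= letter_map_Tagged.
rewrite !big1_seq ?mulg1 ?mul1g // => j /andP[_ js].
  by rewrite /letter_map untag_dflt //; apply: contraNneq iv => <-.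
by rewrite /letter_map untag_dflt //; apply: contraNneq iu => <-.
Qed.

End WordMaps.

Theorem theorem4p11 (G : nat -> topologicalGroupType)
  (G_compact : forall n, compact [set: G n])
  (G_connected : forall n, connected [set: G n])
  (G_hausdorff : forall n, hausdorff_space (G n))
  (G_weight : forall n, weight_le (G n) [set: set nat]) :
  exists (X : groupType) (L : language) (S : expansion L X),
    type_absolutely_connected X /\
    for_sufficiently_big (fun K =>
      forall (Xs : groupType) (Ss : expansion L Xs) (e : X -> Xs),
        monster_model K S Ss e ->
        exists nXs : is_normal_in (component_infty Ss K set0)
                                  (component00 Ss K set0),
          homomorphic_image_of (quotient_group (direct_sum_normal G))
                               (quotient_group nXs) /\
          (infinite_set [set n | ~ abelian_group (G n)] ->
             ~ abelian_group (quotient_group nXs))).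
Proof.
pose SL2Q : groupType := special_linear 2 rat; pose a0 : SL2Q := upper 1%R.
have a0_neqV : a0 != a0^-1 by exact: upper_neqV.
pose X : groupType := free_power {n : nat & G n} SL2Q.
pose S := preimage_expansion (word_map (G := G) a0).
have Xconn : type_absolutely_connected X.
  apply: (@free_power_sl2_type_absolutely_connected _ 2%R) => i j.
  exact: ieexprIn.
exists X, (preimage_language G), S; split=> //.
have big := for_sufficiently_bigI (component00_full S Xconn)
  (for_sufficiently_bigI (component_infty_normal S)
    (product_mod_sum_homomorphic_image G_compact G_hausdorff
      (word_map_almost_morph a0_neqV) (word_map_interpolation a0_neqV))).
apply: for_sufficiently_bigS big => K [full [normal onto]] Xs Ss e mon.
have nXs : is_normal_in (component_infty Ss K set0) (component00 Ss K set0).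
  by rewrite (full _ _ _ mon); exact: normal mon.
exists nXs; have {}onto := onto _ _ _ mon (full _ _ _ mon) nXs; split=> //.
by move=> /product_mod_sum_nonabelian nab /(homomorphic_image_abelian onto).
Qed.
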